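(* Let $p>1$ and $a,b,L>0$. Then: (I) The set $\Lambda^{a,b}_p(0,L)$ of Dirichlet eigenvalues of $-\Delta^{a,b}_p$ on $(0,L)$ is $$\Lambda^{a,b}_p(0,L)=\left\{\lambda^{a,b}_{k,p}(0,L):=\left(\frac{k(a+b)}{2}\right)^p\lambda_{1,p}(0,L):\ k\in\mathbb N\right\}=\left(\frac{a+b}{2}\right)^p\{\lambda_{k,p}(0,L):k\in\mathbb N\}.$$ (II) For $k\in\mathbb N$, a function $u\in W^{1,p}_0(0,L)$ is an eigenfunction of $-\Delta^{a,b}_p$ associated to $\lambda^{a,b}_{k,p}(0,L)$ if and only if either $u(t)=c\,\phi^{a,b}_p\!\left(\frac{kt}{L}\right)$ or $u(t)=c\,\phi^{a,b}_p\!\left(\frac{kt}{L}-1\right)$ for some constant $c>0$.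
   Context: For $p>1$, $a,b,L>0$, the asymmetric $p$-Laplacian $\Delta^{a,b}_p u=\big(a^p[(u')^+]^{p-1}-b^p[(u')^-]^{p-1}\big)'$ is understood weakly: $u\in W^{1,p}_0(0,L)$ is a weak solution of $-\Delta^{a,b}_p u=g$ in $(0,L)$ if $\int_0^L\big(a^p[(u')^+]^{p-1}-b^p[(u')^-]^{p-1}\big)\varphi'\,dt=\int_0^L g\varphi\,dt$ for all $\varphi\in W^{1,p}_0(0,L)$. Here $s^\pm=\max\{\pm s,0\}$. The Dirichlet spectrum is $\Lambda^{a,b}_p(0,L)=\{\lambda\in\mathbb R:$ the problem $-\Delta^{a,b}_p u=\lambda|u|^{p-2}u$ in $(0,L)$, $u(0)=u(L)=0$, has a nontrivial weak solution $u\in W^{1,p}_0(0,L)\}$; such $u$ are the eigenfunctions associated to $\lambda$. $\pi_p:=2\int_0^1(1-t^p)^{-1/p}dt$ and $\lambda_{k,p}(0,L):=(p-1)\left(\frac{k\pi_p}{L}\right)^p$ for $k\in\mathbb N$ (the Dirichlet eigenvalues of the classical $-\Delta_p u=-(|u'|^{p-2}u')'$ on $(0,L)$). $\varphi_p\in W^{1,p}_0(0,1)$ denotes the positive principal eigenfunction of $-\Delta_p$ on $(0,1)$ associated to $\lambda_{1,p}(0,1)$, normalized by $\|\varphi_p\|_{L^p}=1$. Let $t_0=\frac{a}{a+b}$. Define on $[0,1]$: $\varphi^{a,b,+}_p(t)=\varphi_p\!\left(\frac{t}{2t_0}\right)$ for $t\in[0,t_0)$, $\varphi^{a,b,+}_p(t)=\varphi_p\!\left(\frac{t+1-2t_0}{2(1-t_0)}\right)$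 for $t\in[t_0,1]$; $\varphi^{a,b,-}_p(t)=-\varphi_p\!\left(\frac{t}{2(1-t_0)}\right)$ for $t\in[0,1-t_0)$, $\varphi^{a,b,-}_p(t)=-\varphi_p\!\left(\frac{t+2t_0-1}{2t_0}\right)$ for $t\in[1-t_0,1]$. The $2$-periodic function $\phi^{a,b}_p:\mathbb R\to\mathbb R$ is defined by $\phi^{a,b}_p(t)=\varphi^{a,b,+}_p(t)$ for $t\in[0,1)$, $\phi^{a,b}_p(t)=\varphi^{a,b,-}_p(t-1)$ for $t\in[1,2]$, and $\phi^{a,b}_p(t+2)=\phi^{a,b}_p(t)$ for all $t\in\mathbb R$. *)

(* Defs.v *)
From HB Require Import structures.
From mathcomp Require Import all_boot all_order all_algebra.
From mathcomp Require Import all_classical all_reals all_analysis.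
Set Implicit Arguments. Unset Strict Implicit. Unset Printing Implicit Defensive.
Import Order.TTheory GRing.Theory Num.Theory.
Import numFieldNormedType.Exports.
Local Open Scope classical_set_scope.
Local Open Scope ring_scope.

Section Defs.
Variable R : realType.
Local Notation mu := (@lebesgue_measure R).

Definition pi_p (p : R) : R :=
  2 * \int[mu]_(t in `[0, 1]) ((1 - t `^ p) `^ (- p^-1)).

Definition lambda_kp (p : R) (k : nat) (L : R) : R :=
  (p - 1) * ((k%:R * pi_p p / L) `^ p).

Definition lambda_ab_kp (p a b : R) (k : nat) (L : R) : R :=
  ((k%:R * (a + b) / 2) `^ p) * lambda_kp p 1 L.

(* W^{1,p}_0(0,L), one-dimensional description: u is (on [0,L]) the
   primitive u(t) = int_0^t g of a function g in L^p(0,L) (its weak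
   derivative), and u(0) = u(L) = 0. *)
Definition W1p0 (p L : R) (u g : R -> R) : Prop :=
  [/\ mu.-integrable `[0, L] (EFin \o g),
      mu.-integrable `[0, L] (EFin \o (fun t => `|g t| `^ p)),
      (forall t, 0 <= t <= L -> u t = \int[mu]_(s in `[0, t]) g s)
    & u L = 0].

Definition pos_part (s : R) : R := Num.max s 0.
Definition neg_part (s : R) : R := Num.max (- s) 0.

Definition flux_ab (p a b s : R) : R :=
  a `^ p * (pos_part s) `^ (p - 1) - b `^ p * (neg_part s) `^ (p - 1).

Definition flux_p (p s : R) : R := `|s| `^ (p - 2) * s.

Definition rhs_p (p s : R) : R := `|s| `^ (p - 2) * s.

(* u in W^{1,p}_0(0,L) is a weak solution of -(F(u'))' = lam |u|^{p-2} u *)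
Definition weak_eigen_sol (F : R -> R) (p L lam : R) (u : R -> R) : Prop :=
  exists g, W1p0 p L u g /\
    forall phi psi, W1p0 p L phi psi ->
      \int[mu]_(t in `[0, L]) (F (g t) * psi t)
      = lam * \int[mu]_(t in `[0, L]) (rhs_p p (u t) * phi t).

Definition nontrivial (L : R) (u : R -> R) : Prop :=
  exists t, 0 <= t <= L /\ u t != 0.

Definition eigenfunction_ab (p a b L lam : R) (u : R -> R) : Prop :=
  weak_eigen_sol (flux_ab p a b) p L lam u /\ nontrivial L u.

Definition spectrum_ab (p a b L : R) : set R :=
  [set lam | exists u, eigenfunction_ab p a b L lam u].

Definition principal_eigenfunction_p (p : R) (phi : R -> R) : Prop :=
  [/\ weak_eigen_sol (flux_p p) p 1 (lambda_kp p 1 1) phi,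
      (forall t, 0 < t < 1 -> 0 < phi t)
    & \int[mu]_(t in `[0, 1]) (`|phi t| `^ p) = 1].

Definition t0 (a b : R) : R := a / (a + b).

Definition phi_ab_plus (phip : R -> R) (a b t : R) : R :=
  if t < t0 a b then phip (t / (2 * t0 a b))
  else phip ((t + 1 - 2 * t0 a b) / (2 * (1 - t0 a b))).

Definition phi_ab_minus (phip : R -> R) (a b t : R) : R :=
  if t < 1 - t0 a b then - phip (t / (2 * (1 - t0 a b)))
  else - phip ((t + 2 * t0 a b - 1) / (2 * t0 a b)).

Definition phi_ab (phip : R -> R) (a b t : R) : R :=
  let s := t - 2 * (Num.floor (t / 2))%:~R in
  if s < 1 then phi_ab_plus phip a b s else phi_ab_minus phip a b (s - 1).

End Defs.

(* Main.v *)
Require Import Defs.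
From HB Require Import structures.
From mathcomp Require Import all_boot all_order all_algebra.
From mathcomp Require Import ring lra.
From mathcomp Require Import all_classical all_reals all_analysis.
From mathcomp Require Import measurable_realfun.
Set Implicit Arguments. Unset Strict Implicit. Unset Printing Implicit Defensive.
Import Order.TTheory GRing.Theory Num.Theory.
Import numFieldNormedType.Exports.
Local Open Scope classical_set_scope.
Local Open Scope ring_scope.

(* Testing the weak equation against primitives of bounded mean-zero functions
   (du Bois-Reymond) and integrating by parts, [u] is a weak solution exactly
   when, with [w] the flux of [u'], the pair [(u, w)] is a classical solution of
   [u' = G w], [w' = - lam |u|^(p-2) u]; the inverse flux [G] is the flux of the
   conjugate exponent with weights [1/a] and [1/b]. The right-hand sides are not
   Lipschitz at [0], yet the initial value problem has at most one solution: off
   the equilibrium, conservation of energy makes one coordinate a Lipschitz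
   function of the other, which leaves a scalar Gronwall inequality.

   By uniqueness the principal eigenfunction is symmetric about [1/2]; its two
   halves, rescaled in time, glue to the solution [phi_ab] on the whole line,
   which vanishes exactly at the integers. By homogeneity and uniqueness every
   nontrivial solution vanishing at [0] is [c phi_ab(r t)] or
   [c phi_ab(r t - 1)], and the condition at [L] forces [r L] to be a positive
   integer, hence the eigenvalue. The constant [pi_p] is never computed: the
   given principal eigenfunction is the only source of information on
   [lambda_kp p 1 1]. *)

Section Calculus.
Variable R : realType.
Implicit Types (f g h E F : R -> R) (s t x y z c d k m e S T : R).

Lemma is_derive1_continuous f x d : is_derive x 1 f d -> {for x, continuous f}.
Proof. by move=> [fx _]; apply/differentiable_continuous/derivable1_diffP. Qed.

Lemma continuous_left_eq f g x : {for x, continuous f} ->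
  {for x, continuous g} ->
  (\forall y \near x^'-, f y = g y) -> f x = g x.
Proof.
move=> /cvg_at_left_filter f_left /cvg_at_left_filter g_left fg.
apply: (cvg_unique _ f_left) => //; apply: cvg_trans g_left.
by apply: near_eq_cvg; near=> y; apply/esym; near: y.
Unshelve. all: by end_near. Qed.

Lemma is_derive_comp_affine f c d x l :
  is_derive (c * x + d) 1 f l -> is_derive x 1 (fun y => f (c * y + d)) (c * l).
Proof.
have affine : is_derive x 1 (fun y => c * y + d) c.
  by apply: is_derive_eq; rewrite addr0 /GRing.scale/= mulr1.
by move=> df; rewrite mulrC;
  exact: (@is_derive1_comp _ f (fun y => c * y + d) x l c).
Qed.

Lemma is_derive_comp_shift f d x l :
  is_derive (x + d) 1 f l -> is_derive x 1 (fun y => f (y + d)) l.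
Proof.
move=> df; have := @is_derive_comp_affine f 1 d x l; rewrite !mul1r => /(_ df).
by congr is_derive; apply/funext => y; rewrite mul1r.
Qed.

Lemma is_derive_comp_reflect f d x l :
  is_derive (d - x) 1 f l -> is_derive x 1 (fun y => f (d - y)) (- l).
Proof.
move=> df; have := @is_derive_comp_affine f (-1) d x l.
rewrite !mulN1r addrC => /(_ df).
by congr is_derive; apply/funext => y; rewrite mulN1r addrC.
Qed.

Lemma is_derive_if f g m t d : (t <= m -> is_derive t 1 f d) ->
  (m <= t -> is_derive t 1 g d) -> (t = m -> f m = g m) ->
  is_derive t 1 (fun y => if y < m then f y else g y) d.
Proof.
move=> df dg fgm; have [tm|mt|tm] := ltgtP t m.
- apply: near_eq_is_derive (df (ltW tm)); near=> y.
  by rewrite ifT//; near: y; exact: lt_nbhsl.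
- apply: near_eq_is_derive (dg (ltW mt)); near=> y.
  by rewrite ltNge ifF//; apply/negbF/ltW; near: y; exact: lt_nbhsr.
- move: df dg fgm; rewrite -{}tm lexx => /(_ isT) df /(_ isT) dg /(_ erefl) fgt.
  have /is_derive1_caratheodory[f1 [f1E cf1 f1t]] := df.
  have /is_derive1_caratheodory[g1 [g1E cg1 g1t]] := dg.
  apply/is_derive1_caratheodory; exists (fun y => if y < t then f1 y else g1 y).
  split; last by rewrite ltxx.
    by move=> z; rewrite ltxx; case: ifP => _; rewrite -?f1E -?g1E -?fgt.
  rewrite /prop_for /continuous_at ltxx g1t; apply/cvgrPdist_lt => e e0.
  move: cf1 cg1; rewrite /prop_for /continuous_at f1t g1t.
  move=> /cvgrPdist_lt/(_ _ e0) near_f1 /cvgrPdist_lt/(_ _ e0) near_g1.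
  by near=> y; case: ifP => _; near: y.
Unshelve. all: by end_near. Qed.

Lemma within_continuous_pointwise f s t :
  (forall x, s <= x <= t -> {for x, continuous f}) ->
  {within `[s, t], continuous f}.
Proof.
move=> cf; apply: continuous_in_subspaceT => x.
by rewrite inE/= in_itv/=; exact: cf.
Qed.

Lemma mean_value f (df : R -> R) s T : s <= T ->
  (forall t, s <= t <= T -> is_derive t 1 f (df t)) ->
  exists2 c, s <= c <= T & f T - f s = df c * (T - s).
Proof.
move=> sT f'; have [||c cI e] := @MVT_segment R f df s T sT.
- by move=> x; rewrite in_itv/= => xI; apply: f'; lra.
- apply: within_continuous_pointwise => x xI.
  exact: is_derive1_continuous (f' x xI).
- by exists c => //; move: cI; rewrite in_itv.
Qed.

Lemma is_derive_ge0_le f (df : R -> R) s T : s <= T ->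
  (forall t, s <= t <= T -> is_derive t 1 f (df t)) ->
  (forall t, s <= t <= T -> 0 <= df t) -> f s <= f T.
Proof.
move=> sT f' df0; have [c cI e] := mean_value sT f'.
by rewrite -subr_ge0 e mulr_ge0 ?subr_ge0 ?df0.
Qed.

Lemma is_derive0_eq f s T : s <= T ->
  (forall t, s <= t <= T -> is_derive t 1 f 0) -> f s = f T.
Proof.
move=> sT f'; have [c cI] := mean_value sT f'.
by rewrite mul0r => /eqP; rewrite subr_eq0 => /eqP.
Qed.

Lemma continuous_derive_strict E F x e :
  (\forall y \near x, is_derive y (1 : R) E (F y)) ->
  {for x, continuous F} -> 0 < e ->
  exists2 d, 0 < d & forall y z, `|y - x| < d -> `|z - x| < d ->
    `|E y - E z - F x * (y - z)| <= e * `|y - z|.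
Proof.
move=> dE cF e0.
have /nbhs_ballP[d d0 near_x] :
    \forall y \near x, is_derive y (1 : R) E (F y) /\ `|F y - F x| <= e.
  by near=> y; split; near: y => //; exact: (cvgr_distC_le F (F x) cF).
exists d => // y z; wlog zy : y z / z <= y.
  move=> ordered yd zd; have [/ordered|/ltW yz] := leP z y; first exact.
  have -> : E y - E z - F x * (y - z) = - (E z - E y - F x * (z - y)) by ring.
  by rewrite normrN (distrC y); exact: ordered.
move=> yd zd; have inball c : z <= c <= y -> ball x d c.
  by move: yd zd; rewrite /ball/= !ltr_distl => *; lra.
have [c cI ->] := mean_value zy (fun c cI => (near_x c (inball c cI)).1).
rewrite -mulrBl normrM ler_wpM2r//; exact: (near_x c (inball c cI)).2.
Unshelve. all: by end_near. Qed.

Lemma gronwall_eq0 f (df : R -> R) K s T : s <= T ->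
  (forall t, s <= t <= T -> is_derive t 1 f (df t)) ->
  (forall t, s <= t <= T -> `|df t| <= K * `|f t|) -> f s = 0 -> f T = 0.
Proof.
move=> sT f' df_le fs0.
pose N t := - (f t * f t * expR (- (2 * K) * t + 0)).
have N' t : s <= t <= T -> is_derive t 1 N
    (2 * (expR (- (2 * K) * t + 0) * (K * (f t * f t) - f t * df t))).
  move=> tI.
  have dexp := is_derive_comp_affine (is_derive_expR (- (2 * K) * t + 0)).
  have dff := is_deriveM (f' t tI) (f' t tI).
  apply: (is_derive_eq (is_deriveN (is_deriveM dff dexp))).
  by rewrite /GRing.scale/= fctE; ring.
have /is_derive_ge0_le := N' => /(_ sT); rewrite /N fs0 !mul0r oppr0 => N_le.
have : f T * f T * expR (- (2 * K) * T + 0) <= 0.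
  rewrite -oppr_ge0; apply: N_le => t tI.
  rewrite !mulr_ge0 ?expR_ge0// subr_ge0.
  apply: le_trans (ler_norm _) _; rewrite normrM mulrC.
  apply: le_trans (ler_wpM2r (normr_ge0 _) (df_le t tI)) _.
  by rewrite -mulrA -normrM ger0_norm// -expr2 sqr_ge0.
rewrite pmulr_lle0 ?expR_gt0// -expr2 => fT; apply/eqP.
by rewrite -sqrf_eq0 eq_le fT sqr_ge0.
Qed.

Lemma segment_induction (P : R -> Prop) s T : P s ->
  (forall t, s < t <= T -> (forall x, s <= x < t -> P x) -> P t) ->
  (forall t, s <= t < T -> P t -> \forall x \near t^'+, P x) ->
  forall t, s <= t <= T -> P t.
Proof.
move=> Ps Pleft Pright t /andP[st tT].
pose A := [set x | s <= x <= t /\ forall y, s <= y <= x -> P y].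
have As : A s by split=> [|y ys]; [lra|rewrite (_ : y = s)//; lra].
have supA : has_sup A by split; [exists s|exists t => x [/andP[]]].
have sup_ge x : A x -> x <= sup A by apply: ub_le_sup; exact: supA.2.
have s_sup := sup_ge s As.
have sup_t : sup A <= t by apply: ge_sup => [|x [/andP[]]//]; exact: supA.1.
have below y : s <= y < sup A -> P y.
  move=> /andP[sy]; rewrite -subr_gt0 => gap.
  by have [x [_ Px] yx] := sup_adherent gap supA; apply: Px; lra.
have Asup : A (sup A).
  split=> [|y /andP[sy]]; first lra.
  rewrite le_eqVlt => /predU1P[->|ysup]; last by apply: below; lra.
  move: s_sup; rewrite le_eqVlt => /predU1P[<-//|s_sup].
  by apply: Pleft below; lra.
move: sup_t; rewrite le_eqVlt => /predU1P[<-|sup_t].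
  by apply: Asup.2; lra.
have /nbhs_ballP[d /= d0 Pball] : \forall x \near sup A, sup A < x -> P x.
  by apply: Pright; [lra|apply: Asup.2; lra].
pose x := Num.min (sup A + d / 2) t.
have [x_sup xt xd] : [/\ sup A < x, x <= t & x < sup A + d].
  by rewrite /x lt_min ge_min gt_min lexx orbT; split=> //; lra.
suff /sup_ge : A x by rewrite leNgt x_sup.
split=> [|y /andP[sy yx]]; first lra.
have [ysup|ysup] := leP y (sup A); first by apply: Asup.2; lra.
by apply: Pball => //; rewrite /ball/= ltr_distl; lra.
Qed.

End Calculus.

Section HamiltonianUniqueness.
Variable R : realType.
Implicit Types (u w E F G EF EG : R -> R) (s t T x y z c d K : R).

Definition lipschitz_near F x := exists K d, [/\ 0 <= K, 0 < d &
  forall y z, `|y - x| < d -> `|z - x| < d -> `|F y - F z| <= K * `|y - z|].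

Lemma continuous_derive_lipschitz E F x :
  (\forall y \near x, is_derive y (1 : R) E (F y)) -> {for x, continuous F} ->
  lipschitz_near E x.
Proof.
move=> dE cF; have [d d0 strict] := continuous_derive_strict dE cF ltr01.
exists (`|F x| + 1), d; split=> // y z yx zx.
have -> : E y - E z = F x * (y - z) + (E y - E z - F x * (y - z)) by ring.
by apply: le_trans (ler_normD _ _) _; rewrite mulrDl normrM lerD2l;
  exact: strict.
Qed.

Lemma continuous_derive_expanding E F x :
  (\forall y \near x, is_derive y (1 : R) E (F y)) -> {for x, continuous F} ->
  F x != 0 -> exists c d, [/\ 0 < c, 0 < d & forall y z,
    `|y - x| < d -> `|z - x| < d -> c * `|y - z| <= `|E y - E z|].
Proof.
move=> dE cF Fx; have c0 : 0 < `|F x| / 2 by rewrite divr_gt0// normr_gt0.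
have [d d0 strict] := continuous_derive_strict dE cF c0.
exists (`|F x| / 2), d; split=> // y z yx zx.
have := strict y z yx zx.
have := lerB_normD (F x * (y - z)) (E y - E z - F x * (y - z)).
by rewrite subrKC normrM; lra.
Qed.

(* Two-sided derivatives at the endpoints allow solutions to be glued. *)
Definition hamiltonian_sol G F s T u w := forall t, s <= t <= T ->
  is_derive t 1 u (G (w t)) /\ is_derive t 1 w (- F (u t)).

Lemma hamiltonian_solS G F s T s' T' u w : s <= s' -> T' <= T ->
  hamiltonian_sol G F s T u w -> hamiltonian_sol G F s' T' u w.
Proof. by move=> ss' TT' sol t tI; apply: sol; lra. Qed.

Lemma hamiltonian_sol_swap G F s T u w : hamiltonian_sol G F s T u w ->
  hamiltonian_sol (fun x => - F x) (fun x => - G x) s T w u.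
Proof. by move=> sol t tI; have [du dw] := sol t tI; rewrite opprK. Qed.

Lemma hamiltonian_conserved EG G EF F s T u w :
  (forall x, is_derive x 1 EG (G x)) -> (forall x, is_derive x 1 EF (F x)) ->
  s <= T -> hamiltonian_sol G F s T u w ->
  EG (w T) + EF (u T) = EG (w s) + EF (u s).
Proof.
move=> dEG dEF sT sol; apply/esym.
apply: (is_derive0_eq (f := fun t => EG (w t) + EF (u t)) sT) => t tI.
have [du dw] := sol t tI.
apply: (is_derive_eq
  (is_deriveD (is_derive1_comp (dEG _) dw) (is_derive1_comp (dEF _) du))).
by ring.
Qed.

(* The conserved energy expresses [w] as a Lipschitz function of [u], which
   leaves a scalar Gronwall inequality for [u]. *)
Lemma hamiltonian_lipschitz_unique EG G EF F K c C s T u1 w1 u2 w2 :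
  (forall x, is_derive x 1 EG (G x)) -> (forall x, is_derive x 1 EF (F x)) ->
  0 <= K -> 0 < c -> s <= T ->
  hamiltonian_sol G F s T u1 w1 -> hamiltonian_sol G F s T u2 w2 ->
  (forall t, s <= t <= T -> [/\ `|G (w1 t) - G (w2 t)| <= K * `|w1 t - w2 t|,
    c * `|w1 t - w2 t| <= `|EG (w1 t) - EG (w2 t)| &
    `|EF (u1 t) - EF (u2 t)| <= C * `|u1 t - u2 t|]) ->
  u1 s = u2 s -> w1 s = w2 s -> u1 T = u2 T /\ w1 T = w2 T.
Proof.
move=> dEG dEF K0 c0 sT sol1 sol2 lip us ws.
have dist_w t : s <= t <= T -> c * `|w1 t - w2 t| <= `|EF (u1 t) - EF (u2 t)|.
  move=> tI; have [_ expEG _] := lip t tI; apply: le_trans expEG _.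
  have /andP[st tT] := tI.
  have := hamiltonian_conserved dEG dEF st (hamiltonian_solS (lexx s) tT sol1).
  have := hamiltonian_conserved dEG dEF st (hamiltonian_solS (lexx s) tT sol2).
  rewrite us ws (distrC (EF _)) => cons2 cons1.
  by rewrite (_ : EG (w1 t) - EG (w2 t) = EF (u2 t) - EF (u1 t)); lra.
have uT : u1 T = u2 T.
  apply/eqP; rewrite -subr_eq0; apply/eqP.
  apply: (@gronwall_eq0 _ (fun t => u1 t - u2 t) (fun t => G (w1 t) - G (w2 t))
    (K * (C / c)) s T sT) => [t tI|t tI|]; last by rewrite us subrr.
    have [|du1 _] := sol1 t; first lra.
    by have [|du2 _] := sol2 t; [lra|exact: is_deriveB].
  have [lipG _ lipEF] := lip t tI; apply: le_trans lipG _.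
  rewrite -mulrA ler_wpM2l// mulrAC ler_pdivlMr// mulrC.
  exact: le_trans (dist_w t tI) lipEF.
split=> //; have := dist_w T; rewrite sT lexx uT subrr normr0 => /(_ isT).
by rewrite pmulr_rle0// normr_le0 subr_eq0 => /eqP.
Qed.

Lemma hamiltonian_right_unique EG G EF F s T u1 w1 u2 w2 :
  (forall x, is_derive x 1 EG (G x)) -> (forall x, is_derive x 1 EF (F x)) ->
  continuous G -> continuous F -> G (w1 s) != 0 -> lipschitz_near G (w1 s) ->
  s <= T -> hamiltonian_sol G F s T u1 w1 -> hamiltonian_sol G F s T u2 w2 ->
  u1 s = u2 s -> w1 s = w2 s ->
  \forall t \near s^'+, t <= T -> u1 t = u2 t /\ w1 t = w2 t.
Proof.
move=> dEG dEF cG cF Gw [K [dK [K0 dK0 lipG]]] sT sol1 sol2 us ws.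
have [|C [dC [_ dC0 lipEF]]] :=
  @continuous_derive_lipschitz EF F (u1 s) _ (cF _).
  by apply: filterE => x; exact: dEF.
have [|c [dc [c0 dc0 expEG]]] :=
  @continuous_derive_expanding EG G (w1 s) _ (cG _) Gw.
  by apply: filterE => x; exact: dEG.
pose e := Num.min dK (Num.min dc dC).
have e0 : 0 < e by rewrite !lt_min dK0 dc0.
have stay u w : hamiltonian_sol G F s T u w ->
    \forall t \near s, `|u t - u s| < e /\ `|w t - w s| < e.
  move=> sol; have [|du dw] := sol s; first lra.
  near=> t; split; near: t.
    exact: (cvgr_distC_lt u (u s) (is_derive1_continuous du)).
  exact: (cvgr_distC_lt w (w s) (is_derive1_continuous dw)).
have /nbhs_ballP[d /= d0] : \forall t \near s,
    (`|u1 t - u1 s| < e /\ `|w1 t - w1 s| < e) /\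
    (`|u2 t - u2 s| < e /\ `|w2 t - w2 s| < e).
  exact: filterI (stay _ _ sol1) (stay _ _ sol2).
rewrite -us -ws => near_s.
near=> t => tT; have st : s < t by near: t; exact: nbhs_right_gt.
have td : t < s + d by near: t; apply: nbhs_right_lt; lra.
apply: (hamiltonian_lipschitz_unique (C := C) dEG dEF K0 c0 (ltW st)
  (hamiltonian_solS (lexx s) tT sol1)
  (hamiltonian_solS (lexx s) tT sol2)) => // x xI.
have [|[]] := near_s x; first by rewrite /ball/= ltr_distl; lra.
rewrite !lt_min => /and3P[_ _ u1C] /and3P[w1K w1c _].
move=> [/and3P[_ _ u2C] /and3P[w2K w2c _]].
by split; [exact: lipG|exact: expEG|exact: lipEF].
Unshelve. all: by end_near. Qed.

Record restoring_force (E F : R -> R) : Prop := RestoringForce {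
  potential_derive : forall x, is_derive x 1 E (F x);
  potential0 : E 0 = 0;
  force_continuous : continuous F;
  force_mul_gt0 : forall x, x != 0 -> 0 < F x * x;
  force_lipschitz : forall x, x != 0 -> lipschitz_near F x }.

Lemma restoring_forceZ k E F : 0 < k -> restoring_force E F ->
  restoring_force (fun x => k * E x) (fun x => k * F x).
Proof.
move=> k0 [dE E0 cF Fx lipF]; split=> [x||x|x x0|x x0].
- exact: is_deriveZ.
- by rewrite E0 mulr0.
- by apply: cvgZr; exact: cF.
- by rewrite -mulrA mulr_gt0 ?Fx.
have [K [d [K0 d0 lip]]] := lipF x x0; exists (k * K), d.
split=> [||y z yx zx]; [by rewrite mulr_ge0// ltW|by []|].
by rewrite -mulrBr normrM gtr0_norm// -mulrA ler_wpM2l ?(ltW k0)// lip.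
Qed.

Lemma force_neq0 E F x : restoring_force E F -> x != 0 -> F x != 0.
Proof.
by move=> force x0; have := force_mul_gt0 force x0; apply: contraTneq => ->;
  rewrite mul0r ltxx.
Qed.

Lemma potential_gt0 E F x : restoring_force E F -> x != 0 -> 0 < E x.
Proof.
move=> force x0; have dE := potential_derive force.
have cE : continuous E by move=> y; exact: is_derive1_continuous (dE y).
have [x_gt0|x_lt0|xE] := ltgtP 0 x; last by rewrite -xE eqxx in x0.
  have [c] := MVT x_gt0 (fun y _ => dE y) (continuous_subspaceT cE).
  rewrite in_itv/= (potential0 force) !subr0 => /andP[c0 _] ->.
  by rewrite mulr_gt0// -(pmulr_lgt0 _ c0) (force_mul_gt0 force)// gt_eqF.
have [c] := MVT x_lt0 (fun y _ => dE y) (continuous_subspaceT cE).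
rewrite in_itv/= (potential0 force) !sub0r mulrN => /andP[_ c0] /oppr_inj ->.
by rewrite nmulr_rgt0// -(nmulr_lgt0 _ c0) (force_mul_gt0 force)// lt_eqF.
Qed.

Section RestoringForces.
Variables (EG G EF F : R -> R) (s T : R).
Hypothesis restoringG : restoring_force EG G.
Hypothesis restoringF : restoring_force EF F.

Lemma restoring_at_rest t u w x : hamiltonian_sol G F t T u w ->
  u t = 0 -> w t = 0 -> t <= x <= T -> u x = 0 /\ w x = 0.
Proof.
have [dEG EG0 _ _ _] := restoringG; have [dEF EF0 _ _ _] := restoringF.
move=> sol ut0 wt0 /andP[tx xT].
have := hamiltonian_conserved dEG dEF tx (hamiltonian_solS (lexx t) xT sol).
rewrite ut0 wt0 EG0 EF0 addr0.
have [->|/(potential_gt0 restoringF) u_gt0] := eqVneq (u x) 0;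
  have [->|/(potential_gt0 restoringG) w_gt0] := eqVneq (w x) 0 => //;
  rewrite ?EG0 ?EF0; lra.
Qed.

Lemma restoring_right_unique t u1 w1 u2 w2 : t <= T ->
  hamiltonian_sol G F t T u1 w1 -> hamiltonian_sol G F t T u2 w2 ->
  u1 t = u2 t -> w1 t = w2 t ->
  \forall x \near t^'+, x <= T -> u1 x = u2 x /\ w1 x = w2 x.
Proof.
have [dEG _ cG _ lipG] := restoringG; have [dEF _ cF _ lipF] := restoringF.
move=> tT sol1 sol2 ut wt; have [w0|w0] := eqVneq (w1 t) 0; last first.
  apply: (hamiltonian_right_unique dEG dEF) => //; last exact: lipG.
  exact: force_neq0 restoringG w0.
have [u0|u0] := eqVneq (u1 t) 0; last first.
  have derive_opp (E H : R -> R) : (forall x, is_derive x 1 E (H x)) ->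
    forall x, is_derive x 1 (fun y => - E y) (- H x).
    by move=> dE x; exact: is_deriveN.
  have continuous_opp (H : R -> R) :
      continuous H -> continuous (fun x => - H x).
    by move=> cH x; apply: cvgN; exact: cH.
  have lip : lipschitz_near (fun x => - F x) (u1 t).
    have [K [d [K0 d0 lip]]] := lipF _ u0; exists K, d.
    by split=> // y z yx zx; rewrite -opprD normrN; exact: lip.
  have := hamiltonian_right_unique (derive_opp _ _ dEF) (derive_opp _ _ dEG)
    (continuous_opp _ cF) (continuous_opp _ cG) _ lip tT
    (hamiltonian_sol_swap sol1) (hamiltonian_sol_swap sol2) wt ut.
  rewrite oppr_eq0 (force_neq0 restoringF u0) => /(_ isT).
  by apply: filterS => x swapped /swapped[].
near=> x => xT; have tx : t <= x by near: x; exact: nbhs_right_ge.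
have [|-> ->] := restoring_at_rest sol1 u0 w0 (x := x); first lra.
by have [|||-> ->] := restoring_at_rest sol2 _ _ (x := x);
  rewrite -?ut -?wt //; lra.
Unshelve. all: by end_near. Qed.

Lemma hamiltonian_unique u1 w1 u2 w2 :
  hamiltonian_sol G F s T u1 w1 -> hamiltonian_sol G F s T u2 w2 ->
  u1 s = u2 s -> w1 s = w2 s ->
  forall t, s <= t <= T -> u1 t = u2 t /\ w1 t = w2 t.
Proof.
move=> sol1 sol2 us ws; apply: segment_induction => // t tI; last first.
  move=> [ut wt]; have /andP[st tT] := tI.
  have right := restoring_right_unique (ltW tT)
    (hamiltonian_solS st (lexx T) sol1)
    (hamiltonian_solS st (lexx T) sol2) ut wt.
  near=> x; have : x <= T by apply: ltW; near: x; exact: nbhs_right_lt.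
  by near: x.
move=> agree; have [|du1 dw1] := sol1 t; first lra.
have [|du2 dw2] := sol2 t; first lra.
have near_left : \forall x \near t^'-, u1 x = u2 x /\ w1 x = w2 x.
  near=> x; apply: agree; apply/andP; split; near: x; last exact: nbhs_left_lt.
  by apply: nbhs_left_ge; lra.
split; apply: continuous_left_eq.
- exact: is_derive1_continuous du1.
- exact: is_derive1_continuous du2.
- by apply: filterS near_left => x [].
- exact: is_derive1_continuous dw1.
- exact: is_derive1_continuous dw2.
- by apply: filterS near_left => x [].
Unshelve. all: by end_near. Qed.

End RestoringForces.
End HamiltonianUniqueness.

Section Flux.
Variable R : realType.
Implicit Types (p q r s t x a b d lam : R) (u : R -> R).

Lemma pos_partE s : 0 <= s -> pos_part s = s.
Proof. by move=> s0; rewrite /pos_part max_l. Qed.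

Lemma pos_part0 s : s <= 0 -> pos_part s = 0.
Proof. by move=> s0; rewrite /pos_part max_r. Qed.

Lemma pos_part_ge0 s : 0 <= pos_part s.
Proof. by rewrite /pos_part le_max lexx orbT. Qed.

Lemma pos_part_le_norm s : pos_part s <= `|s|.
Proof. by rewrite /pos_part ge_max ler_norm normr_ge0. Qed.

Lemma pos_partM r s : 0 <= r -> pos_part (r * s) = r * pos_part s.
Proof. by move=> r0; rewrite /pos_part maxr_pMr// mulr0. Qed.

Lemma continuous_pos_part_powR r : 0 < r ->
  continuous (fun x => pos_part x `^ r).
Proof.
move=> r0 x; have [x0|x0|<-] := ltgtP 0 x.
- rewrite /continuous_at pos_partE ?ltW//.
  apply: cvg_trans (is_derive1_continuous (is_derive1_powR r x0)).
  apply: near_eq_cvg; near=> y; rewrite pos_partE// ltW//.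
  by near: y; exact: lt_nbhsr.
- rewrite /continuous_at pos_part0 ?ltW//.
  apply: cvg_near_cst; near=> y; rewrite pos_part0// ltW//.
  by near: y; exact: lt_nbhsl.
- rewrite /continuous_at pos_part0// powR0 ?gt_eqF//.
  apply/cvgrPdist_lt => e e0; have root_gt0 : 0 < e `^ r^-1 by exact: powR_gt0.
  have rootK : e = (e `^ r^-1) `^ r.
    by rewrite -powRrM mulVf ?powRr1 ?ltW// gt_eqF.
  near=> y; rewrite sub0r normrN ger0_norm ?powR_ge0// [ltRHS]rootK.
  rewrite gt0_ltr_powR ?nnegrE ?powR_ge0 ?pos_part_ge0//.
  by apply: le_lt_trans (pos_part_le_norm y) _; near: y;
    exact: (@nbhs0_lt R R _ root_gt0).
Unshelve. all: by end_near. Qed.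

Lemma continuous_normr_powR r : 0 < r -> continuous (fun x : R => `|x| `^ r).
Proof.
move=> r0 x.
rewrite (_ : (fun y => _) = (fun y => pos_part y `^ r) \o Num.norm).
  apply: continuous_comp;
    [exact: norm_continuous|exact: continuous_pos_part_powR].
by apply/funext => y; rewrite /= pos_partE.
Qed.

Lemma is_derive_pos_part_powR r x : 1 < r ->
  is_derive x 1 (fun x => pos_part x `^ r) (r * pos_part x `^ (r - 1)).
Proof.
move=> r1; have r0 : r != 0 by rewrite gt_eqF//; lra.
have rB1 : r - 1 != 0 by rewrite subr_eq0 gt_eqF.
have [x0|x0|<-] := ltgtP 0 x.
- rewrite pos_partE ?ltW//.
  apply: near_eq_is_derive (is_derive1_powR r x0); near=> y.
  by rewrite pos_partE// ltW//; near: y; exact: lt_nbhsr.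
- rewrite pos_part0 ?ltW// powR0// mulr0.
  apply: near_eq_is_derive (is_derive_cst (0 : R) x 1); near=> y.
  by rewrite pos_part0 ?powR0// ltW//; near: y; exact: lt_nbhsl.
- apply/is_derive1_caratheodory; exists (fun y => pos_part y `^ (r - 1)).
  rewrite (pos_part0 (lexx 0)) !powR0// mulr0; split => // [z|].
    rewrite !subr0; have [z0|/ltW z0] := leP 0 z.
      by rewrite pos_partE// mulrC mulr_powRB1//; lra.
    by rewrite pos_part0// !powR0// mul0r.
  by apply: continuous_pos_part_powR; lra.
Unshelve. all: by end_near. Qed.

Definition conj_exp p := p / (p - 1).

Lemma conj_exp_gt1 p : 1 < p -> 1 < conj_exp p.
Proof. by move=> p1; rewrite /conj_exp ltr_pdivlMr ?subr_gt0//; lra. Qed.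

Lemma conj_expB1 p : 1 < p -> conj_exp p - 1 = (p - 1)^-1.
Proof. by move=> p1; rewrite /conj_exp; field; rewrite gt_eqF//; lra. Qed.

Lemma conj_expK p : 1 < p -> conj_exp (conj_exp p) = p.
Proof.
move=> p1; rewrite {1}/conj_exp conj_expB1// invrK /conj_exp divfK//.
by rewrite gt_eqF//; lra.
Qed.

Section FixedExponent.
Variable p : R.
Hypothesis p_gt1 : 1 < p.
Let p_gt0 : 0 < p. Proof. exact: lt_trans p_gt1. Qed.
Let pB1_gt0 : 0 < p - 1. Proof. by rewrite subr_gt0. Qed.

Lemma flux_abE a b s : flux_ab p a b s =
  a `^ p * pos_part s `^ (p - 1) - b `^ p * pos_part (- s) `^ (p - 1).
Proof. by []. Qed.

Lemma continuous_flux a b : continuous (flux_ab p a b).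
Proof.
move=> x; apply: cvgB; apply: cvgMl_tmp.
  exact: continuous_pos_part_powR.
apply: (continuous_comp (f := fun y => - y)
  (g := fun y => pos_part y `^ (p - 1))).
  exact: opp_continuous.
exact: continuous_pos_part_powR.
Qed.

Lemma continuous_flux_comp a b u t d : is_derive t 1 u d ->
  {for t, continuous (fun x => flux_ab p a b (u x))}.
Proof.
move=> du; exact: (continuous_comp (is_derive1_continuous du)
  (@continuous_flux a b (u t))).
Qed.

Lemma fluxN a b s : flux_ab p a b (- s) = - flux_ab p b a s.
Proof. by rewrite !flux_abE opprK opprB. Qed.

Lemma flux_ge0E a b s : 0 <= s -> flux_ab p a b s = a `^ p * s `^ (p - 1).
Proof.
move=> s0; rewrite flux_abE pos_partE// pos_part0 ?oppr_le0//.
by rewrite powR0 ?mulr0 ?subr0// gt_eqF.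
Qed.

Lemma flux0 a b : flux_ab p a b 0 = 0.
Proof. by rewrite flux_ge0E// powR0 ?mulr0// gt_eqF. Qed.

Lemma flux_gt0 a b s : 0 < a -> 0 < s -> 0 < flux_ab p a b s.
Proof. by move=> a0 s0; rewrite flux_ge0E ?ltW// mulr_gt0// powR_gt0. Qed.

Lemma flux_lt0 a b s : 0 < b -> s < 0 -> flux_ab p a b s < 0.
Proof.
by move=> b0 s0; rewrite -[s]opprK fluxN oppr_lt0 flux_gt0// oppr_gt0.
Qed.

Lemma flux_mul_gt0 a b s : 0 < a -> 0 < b -> s != 0 -> 0 < flux_ab p a b s * s.
Proof.
move=> a0 b0; rewrite neq_lt => /orP[s0|s0].
  by rewrite nmulr_lgt0// flux_lt0.
by rewrite mulr_gt0// flux_gt0.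
Qed.

Lemma flux_le_norm a b s :
  `|flux_ab p a b s| <= (a `^ p + b `^ p) * `|s| `^ (p - 1).
Proof.
rewrite flux_abE (le_trans (ler_normB _ _))// mulrDl.
rewrite lerD// ger0_norm ?mulr_ge0 ?powR_ge0// ler_wpM2l ?powR_ge0//;
  apply: ge0_ler_powR; rewrite ?nnegrE ?pos_part_ge0 ?(ltW pB1_gt0)//.
  exact: pos_part_le_norm.
by rewrite -(normrN s) pos_part_le_norm.
Qed.

Lemma flux_homo a b r s : 0 <= r ->
  flux_ab p a b (r * s) = r `^ (p - 1) * flux_ab p a b s.
Proof.
move=> r0; rewrite !flux_abE -[- (r * s)]mulrN !pos_partM//.
by rewrite !powRM ?pos_part_ge0//; ring.
Qed.

Lemma flux_pE s : flux_p p s = flux_ab p 1 1 s.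
Proof.
have powRB2M r : 0 < r -> r `^ (p - 2) * r = r `^ (p - 1).
  move=> r0; rewrite mulrC -(mulr_powRB1 (ltW r0) pB1_gt0).
  by congr (_ * _ `^ _); ring.
rewrite /flux_p; have [s0|s0|<-] := ltgtP 0 s; last by rewrite mulr0 flux0.
  by rewrite flux_ge0E ?ltW// powR1 mul1r gtr0_norm// powRB2M.
rewrite -[s in RHS]opprK fluxN flux_ge0E ?oppr_ge0 ?ltW// powR1 mul1r.
by rewrite -powRB2M ?oppr_gt0// ltr0_norm// mulrN opprK.
Qed.

Definition energy a b s : R :=
  p^-1 * (a `^ p * pos_part s `^ p + b `^ p * pos_part (- s) `^ p).

Lemma is_derive_energy a b s : is_derive s 1 (energy a b) (flux_ab p a b s).
Proof.
have pos := is_derive_pos_part_powR s p_gt1.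
have neg : is_derive s 1 (fun y => pos_part (- y) `^ p)
    (- (p * pos_part (- s) `^ (p - 1))).
  under eq_fun do rewrite -sub0r.
  apply: (@is_derive_comp_reflect _ (fun y => pos_part y `^ p)).
  by rewrite sub0r; exact: is_derive_pos_part_powR.
apply: (is_derive_eq (is_deriveZ p^-1
  (is_deriveD (is_deriveZ (a `^ p) pos) (is_deriveZ (b `^ p) neg)))).
by rewrite /GRing.scale/= flux_abE; field; rewrite gt_eqF.
Qed.

Lemma energy_symE s : energy 1 1 s = p^-1 * `|s| `^ p.
Proof.
rewrite /energy powR1 !mul1r; congr (_ * _).
wlog s0 : s / 0 <= s.
  move=> nneg; have [/nneg//|/ltW s0] := leP 0 s.
  by rewrite addrC -{2}[s]opprK nneg ?normrN// oppr_ge0.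
by rewrite pos_partE// pos_part0 ?oppr_le0// powR0 ?gt_eqF// addr0 ger0_norm.
Qed.

Lemma lipschitz_near_flux a b s : s != 0 -> lipschitz_near (flux_ab p a b) s.
Proof.
wlog s0 : a b s / 0 < s.
  move=> pos s0; have [/pos|s_lt0|s0E] := ltgtP 0 s;
    [exact| |by rewrite -s0E eqxx in s0].
  have [||K [d [K0 d0 lip]]] := pos b a (- s); rewrite ?oppr_gt0 ?oppr_eq0//.
  exists K, d; split=> // y z ys zs.
  have := lip (- y) (- z); rewrite !fluxN.
  by rewrite -!opprD !normrN; apply.
move=> _; pose dflux y := a `^ p * ((p - 1) * y `^ (p - 1 - 1)).
apply: (@continuous_derive_lipschitz _ (flux_ab p a b) dflux); last first.
  apply: cvgMl_tmp; apply: cvgMl_tmp.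
  exact: is_derive1_continuous (is_derive1_powR (p - 1 - 1) s0).
near=> y; have y0 : 0 < y by near: y; exact: lt_nbhsr.
apply: near_eq_is_derive (is_deriveZ (a `^ p) (is_derive1_powR (p - 1) y0)).
near=> z; rewrite flux_ge0E// ltW//; near: z; exact: lt_nbhsr.
Unshelve. all: by end_near. Qed.

Lemma restoring_flux a b : 0 < a -> 0 < b ->
  restoring_force (energy a b) (flux_ab p a b).
Proof.
move=> a0 b0; split=> [x|||x|x].
- exact: is_derive_energy.
- by rewrite /energy oppr0 pos_part0// powR0 ?gt_eqF// !mulr0 addr0 mulr0.
- exact: continuous_flux.
- exact: flux_mul_gt0.
- exact: lipschitz_near_flux.
Qed.

End FixedExponent.

Lemma fluxK p a b : 1 < p -> 0 < a -> 0 < b ->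
  cancel (flux_ab p a b) (flux_ab (conj_exp p) a^-1 b^-1).
Proof.
move=> p1 a0 b0 s; have q1 := conj_exp_gt1 p1.
wlog s0 : a b s a0 b0 / 0 <= s.
  move=> nneg; have [/nneg|/ltW s0] := leP 0 s; first exact.
  by rewrite -[s in LHS]opprK (fluxN p a b) fluxN nneg ?opprK ?oppr_ge0.
rewrite (flux_ge0E p1 _ _ s0) flux_ge0E ?mulr_ge0 ?powR_ge0// conj_expB1//.
rewrite powRM ?powR_ge0// -!powRrM divff ?powRr1 ?gt_eqF ?subr_gt0//.
by rewrite mulrA -powRM ?invr_ge0 ?(ltW a0)// mulVf ?gt_eqF// powR1 mul1r.
Qed.

Lemma flux_invK p a b : 1 < p -> 0 < a -> 0 < b ->
  cancel (flux_ab (conj_exp p) a^-1 b^-1) (flux_ab p a b).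
Proof.
move=> p1 a0 b0 s; have := @fluxK (conj_exp p) a^-1 b^-1 (conj_exp_gt1 p1).
by rewrite !invr_gt0 conj_expK// !invrK; apply.
Qed.

End Flux.

Section MeanValueZero.
Context d (T : measurableType d) (R : realType).
Variables (mu : {measure set T -> \bar R}) (D : set T).
Hypothesis mD : measurable D.
Implicit Types f g v psi : T -> R.

Lemma EFin_Rintegral f : mu.-integrable D (EFin \o f) ->
  (\int[mu]_(x in D) f x)%:E = (\int[mu]_(x in D) (f x)%:E)%E.
Proof. by move=> fi; rewrite fineK// integrable_fin_num. Qed.

Lemma integrable_bounded_mul f g M : measurable_fun D f ->
  (forall x, D x -> `|f x| <= M) -> mu.-integrable D (EFin \o g) ->
  mu.-integrable D (EFin \o (fun x => f x * g x)).
Proof.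
move=> mf fM gi; apply: (integrableMr mD mf _ gi).
exists M; split=> [|y My x Dx]; first exact: num_real.
exact: le_trans (fM x Dx) (ltW My).
Qed.

Lemma Rintegral_norm_eq0 f : mu.-integrable D (EFin \o f) ->
  \int[mu]_(x in D) `|f x| = 0 -> ae_eq mu D f (cst 0).
Proof.
move=> fi f0; have mf : measurable_fun D (EFin \o f) by case/integrableP: fi.
have /(ae_eq_integral_abs mu mD mf) :
  (\int[mu]_(x in D) `|(EFin \o f) x| = 0)%E.
  by rewrite -[RHS]/(0%:E) -f0 EFin_Rintegral//; exact: integrable_norm.
by apply: filterS => x /= + Dx => /(_ Dx) [].
Qed.

Lemma Rintegral_ae_eq f g : mu.-integrable D (EFin \o f) ->
  mu.-integrable D (EFin \o g) -> ae_eq mu D f g ->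
  \int[mu]_(x in D) f x = \int[mu]_(x in D) g x.
Proof.
move=> /integrableP[mf _] /integrableP[mg _] fg; congr fine.
by apply: ae_eq_integral => //; exact: (ae_eq_comp EFin fg).
Qed.

Definition average f := (\int[mu]_(x in D) f x) / fine (mu D).

Section FiniteMeasure.
Hypotheses (D_gt0 : (0 < mu D)%E) (D_fin : (mu D < +oo)%E).

Lemma bounded_integrable f M : measurable_fun D f ->
  (forall x, D x -> `|f x| <= M) -> mu.-integrable D (EFin \o f).
Proof.
move=> mf fM; apply: measurable_bounded_integrable => //.
exists M; split=> [|y My x Dx]; first exact: num_real.
exact: le_trans (fM x Dx) (ltW My).
Qed.

Lemma integrable_cst k : mu.-integrable D (EFin \o cst k).
Proof. exact: (@bounded_integrable _ `|k|). Qed.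

Lemma integrable_subr_average f : mu.-integrable D (EFin \o f) ->
  mu.-integrable D (EFin \o (fun x => f x - average f)).
Proof.
by move=> fi; exact: (integrableB mD fi (integrable_cst (average f))).
Qed.

Lemma Rintegral_subr_average f : mu.-integrable D (EFin \o f) ->
  \int[mu]_(x in D) (f x - average f) = 0.
Proof.
move=> fi; rewrite RintegralB//; last exact: integrable_cst.
by rewrite Rintegral_cst// divfK ?subrr// gt_eqF// fine_gt0// D_gt0.
Qed.

(* With [z] the deviation of [v] from its average, the test function
   [sgn z - average (sgn z)] gives the integral of [`|z|]. *)
Lemma du_bois_reymond v : mu.-integrable D (EFin \o v) ->
  (forall psi, measurable_fun D psi ->
    (exists M, forall x, D x -> `|psi x| <= M) ->
    \int[mu]_(x in D) psi x = 0 -> \int[mu]_(x in D) (v x * psi x) = 0) ->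
  ae_eq mu D v (cst (average v)).
Proof.
move=> vi ortho; pose z x := v x - average v.
have zi : mu.-integrable D (EFin \o z) by exact: integrable_subr_average.
have mz : measurable_fun D z by exact/measurable_EFinP/(measurable_int mu).
pose sgn (y : R) : R := if y < 0 then -1 else 1.
have sgnM y : sgn y * y = `|y|.
  by rewrite /sgn; case: ltP => [/ltr0_norm ->|/ger0_norm ->];
    rewrite ?mulN1r ?mul1r.
have sgn_le1 y : `|sgn y| <= 1.
  by rewrite /sgn; case: ifP; rewrite ?normrN normr1.
have msz : measurable_fun D (sgn \o z).
  apply: measurableT_comp mz; apply: measurable_fun_ifT => //.
  exact: measurable_fun_ltr.
pose k := average (sgn \o z); pose psi x := (sgn \o z) x - k.
have mpsi : measurable_fun D psi by exact: measurable_funB.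
have psi_le x : D x -> `|psi x| <= 1 + `|k|.
  by move=> _; apply: le_trans (ler_normB _ _) _; rewrite lerD2r;
    exact: sgn_le1.
have szi : mu.-integrable D (EFin \o (sgn \o z)).
  by exact: bounded_integrable msz (fun x _ => sgn_le1 (z x)).
have psii : mu.-integrable D (EFin \o psi) by exact: integrable_subr_average.
have psi0 : \int[mu]_(x in D) psi x = 0 by exact: Rintegral_subr_average szi.
have vpsi0 := ortho psi mpsi (ex_intro _ _ psi_le) psi0.
have vpsii : mu.-integrable D (EFin \o (fun x => v x * psi x)).
  by under eq_fun do rewrite mulrC; exact: (integrable_bounded_mul mpsi psi_le).
have : ae_eq mu D z (cst 0).
  apply: Rintegral_norm_eq0 => //.
  transitivity (\int[mu]_(x in D) (v x * psi x - average v * psi x + k * z x)).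
    by apply: eq_Rintegral => x _; rewrite -sgnM /psi /z /=; ring.
  have cpsii : mu.-integrable D (EFin \o (fun x => average v * psi x)).
    exact: (integrableZl mD (average v) psii).
  have kzi : mu.-integrable D (EFin \o (fun x => k * z x)).
    exact: (integrableZl mD k zi).
  rewrite RintegralD//; last exact: (integrableB mD vpsii cpsii).
  rewrite RintegralB// !RintegralZl// vpsi0 psi0 Rintegral_subr_average//.
  by rewrite !mulr0 subrr addr0.
by apply: filterS => x /= z0 Dx; apply/eqP; rewrite -subr_eq0; apply/eqP/z0.
Qed.

End FiniteMeasure.
End MeanValueZero.

Section Tensor.
Context d1 d2 (T1 : measurableType d1) (T2 : measurableType d2) (R : realType).
Variables (m1 : {sigma_finite_measure set T1 -> \bar R}).
Variables (m2 : {sigma_finite_measure set T2 -> \bar R}).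

Lemma integrable_tensor (f : T1 -> R) (g : T2 -> R) :
  m1.-integrable setT (EFin \o f) -> m2.-integrable setT (EFin \o g) ->
  (m1 \x m2)%E.-integrable setT (EFin \o (fun z => f z.1 * g z.2)).
Proof.
move=> fi gi; have [/measurable_EFinP mf fabs] := integrableP _ _ _ fi.
have [/measurable_EFinP mg gabs] := integrableP _ _ _ gi.
apply/integrable12ltyP.
  by apply/measurable_EFinP/measurable_funM; exact: measurableT_comp.
have mfabs : measurable_fun setT (fun x => `|(f x)%:E|%E).
  by exact/measurableT_comp/measurable_EFinP.
have mgabs : measurable_fun setT (fun y => `|(g y)%:E|%E).
  by exact/measurableT_comp/measurable_EFinP.
have gabs_ge0 : (0 <= \int[m2]_y `|(g y)%:E|)%E by exact: integral_ge0.
under eq_integral => x _.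
  under eq_integral => y _ do rewrite /= normrM EFinM.
  rewrite (ge0_integralZl m2 measurableT mgabs)//; over.
rewrite (ge0_integralZr m1 measurableT mfabs)//.
by rewrite lte_mul_pinfty ?integral_ge0// ge0_fin_numE ?integral_ge0.
Qed.

End Tensor.

Section Triangle.
Variable R : realType.
Local Notation mu := (@lebesgue_measure R).
Implicit Types (f g : R -> R) (s t x y T : R).

Definition triangle_kernel f g (z : R * R) :=
  if z.1 <= z.2 then f z.1 * g z.2 else 0.

Lemma integrable_triangle_kernel f g : mu.-integrable setT (EFin \o f) ->
  mu.-integrable setT (EFin \o g) ->
  (mu \x mu)%E.-integrable setT (EFin \o triangle_kernel f g).
Proof.
move=> fi gi; have [/measurable_EFinP mf _] := integrableP _ _ _ fi.
have [/measurable_EFinP mg _] := integrableP _ _ _ gi.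
apply: le_integrable (integrable_tensor fi gi) => //.
  apply/measurable_EFinP/measurable_fun_ifT => //;
    first exact: measurable_fun_ler.
  by apply: measurable_funM; exact: measurableT_comp.
move=> z _; rewrite lee_fin /triangle_kernel; case: ifP => // _.
by rewrite normr0.
Qed.

Lemma integral_triangle_kernel1 f g x : mu.-integrable setT (EFin \o g) ->
  (\int[mu]_y (triangle_kernel f g (x, y))%:E =
    (f x * (\int[mu]_(y in `[x, +oo[) g y)%R)%:E)%E.
Proof.
move=> gi; have {}gi :
  mu.-integrable `[x, +oo[ (EFin \o g) by apply: integrableS gi.
rewrite -RintegralZl// EFin_Rintegral//; last exact: (integrableZl _ (f x) gi).
rewrite [RHS]integral_mkcond; apply: eq_integral => y _.
by rewrite patchE mem_setE in_itv/= andbT /triangle_kernel/=; case: ifP.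
Qed.

Lemma integral_triangle_kernel2 f g y : mu.-integrable setT (EFin \o f) ->
  (\int[mu]_x (triangle_kernel f g (x, y))%:E =
    ((\int[mu]_(x in `]-oo, y]) f x)%R * g y)%:E)%E.
Proof.
move=> fi; have {}fi :
  mu.-integrable `]-oo, y] (EFin \o f) by apply: integrableS fi.
rewrite -RintegralZr// EFin_Rintegral//; last exact: (integrableZr _ (g y) fi).
rewrite [RHS]integral_mkcond; apply: eq_integral => x _.
by rewrite patchE mem_setE in_itv/= /triangle_kernel/=; case: ifP.
Qed.

Lemma Rintegral_triangle f g :
  mu.-integrable setT (EFin \o f) -> mu.-integrable setT (EFin \o g) ->
  \int[mu]_x (f x * \int[mu]_(y in `[x, +oo[) g y) =
  \int[mu]_y ((\int[mu]_(x in `]-oo, y]) f x) * g y).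
Proof.
move=> fi gi; congr fine.
have := Fubini (integrable_triangle_kernel fi gi) => /=.
under eq_integral do rewrite integral_triangle_kernel1//.
by under [in RHS]eq_integral do rewrite integral_triangle_kernel2//.
Qed.

End Triangle.

Section Segment.
Variable R : realType.
Local Notation mu := (@lebesgue_measure R).
Local Notation segment s t := (`[s, t]%classic : set (measurableTypeR R)).
Implicit Types (f g h F : R -> R) (s t m x y L T : R).

(* [measurable_itv], at a type for which unification finds the Borel sets. *)
Lemma measurable_segment s t : measurable (segment s t).
Proof. exact: measurable_itv. Qed.

Lemma integrable_within_continuous f s t :
  {within `[s, t], continuous f} -> mu.-integrable `[s, t] (EFin \o f).
Proof.
by move=> cf; apply: continuous_compact_integrable => //;
  exact: segment_compact.
Qed.

Lemma integrable_itvS f s t s' t' : s <= s' -> t' <= t ->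
  mu.-integrable `[s, t] (EFin \o f) -> mu.-integrable `[s', t'] (EFin \o f).
Proof.
move=> ss' t't; apply: integrableS => //.
by apply: subset_itv; rewrite bnd_simp.
Qed.

Lemma Rintegral_itv_cat f s m t : s <= m -> m <= t ->
  mu.-integrable `[s, t] (EFin \o f) ->
  \int[mu]_(x in `[s, t]) f x =
  \int[mu]_(x in `[s, m]) f x + \int[mu]_(x in `[m, t]) f x.
Proof.
move=> sm mt fi; rewrite -(@Rintegral_itv_obnd_cbnd _ m); last first.
  by apply: integrableS fi => //; apply: subset_itv; rewrite bnd_simp.
by rewrite -(@Rintegral_itvB _ _ _ _ m fi) ?bnd_simp// subrKC.
Qed.

Lemma within_continuous_bounded f s t : s <= t ->
  {within `[s, t], continuous f} ->
  exists2 M : R, 0 < M & forall x, `[s, t]%classic x -> `|f x| <= M.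
Proof.
move=> st cf; have cn : {within `[s, t], continuous (fun x => `|f x|)}.
  by move=> x; apply: cvg_norm; exact: cf.
have [c _ fc] := EVT_max st cn.
exists (`|f c| + 1) => [|x xI]; first by rewrite ltr_wpDl.
by apply: le_trans (fc x xI) _; rewrite lerDl.
Qed.

Lemma Rintegral_is_derive f F s t : s <= t ->
  (forall x, s <= x <= t -> is_derive x 1 F (f x)) ->
  {within `[s, t], continuous f} ->
  \int[mu]_(x in `[s, t]) f x = F t - F s.
Proof.
rewrite le_eqVlt => /predU1P[<- _ _|st dF cf].
  by rewrite set_itv1 Rintegral_set1 subrr.
have cF : {within `[s, t], continuous F}.
  by apply: within_continuous_pointwise => x xI;
    exact: is_derive1_continuous (dF x xI).
have [_ cFs cFt] := (continuous_within_itvP F st).1 cF.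
rewrite /Rintegral (@continuous_FTC2 _ f F)//.
  by split=> // x; rewrite in_itv/= => /andP[sx xt]; have [|] := dF x;
    first by rewrite !ltW.
by move=> x; rewrite in_itv/= derive1E => /andP[sx xt]; have [|] := dF x;
  first by rewrite !ltW.
Qed.

Lemma continuous_primitive f s T : s <= T -> {within `[s, T], continuous f} ->
  exists P : R -> R, forall t, s <= t <= T ->
    is_derive t 1 P (f t) /\ P t = \int[mu]_(x in `[s, t]) f x.
Proof.
move=> sT cf; have [M M0 fM] := within_continuous_bounded sT cf.
have [fe [fE cfe _]] := continuous_bounded_extension
  (@pseudometric_normal R R) (@itv_closed _ _ s T) M0 cf fM.
have fei : mu.-integrable `[s - 1, T + 1] (EFin \o fe).
  by apply: integrable_within_continuous; exact: continuous_subspaceT.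
pose P t := \int[mu]_(x in `[s - 1, t]) fe x; exists (fun t => P t - P s).
move=> t /andP[st tT]; have t_lt : t < T + 1 by lra.
have [|dP P'] := continuous_FTC1_closed t_lt fei _ (cfe t); first lra.
have fE_t x : s <= x <= t -> f x = fe x.
  by move=> xI; apply: fE; rewrite inE/= in_itv/=; lra.
split.
  have dPt : is_derive t 1 P (fe t).
    by apply: DeriveDef; [exact: dP|rewrite -derive1E; exact: P'].
  rewrite fE_t ?st ?lexx// -[fe t]subr0.
  exact: (is_deriveB dPt (is_derive_cst (P s) t 1)).
have fetI : mu.-integrable `[s - 1, t] (EFin \o fe).
  by apply: integrable_itvS fei; lra.
rewrite /P (Rintegral_itv_cat _ st fetI); last by rewrite gerBl.
rewrite addrC addKr; apply: eq_Rintegral => x; rewrite inE/= in_itv/= => xI.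
by rewrite fE_t.
Qed.

Lemma Rintegral_triangle_itv f g s T : mu.-integrable `[s, T] (EFin \o f) ->
  mu.-integrable `[s, T] (EFin \o g) ->
  \int[mu]_(x in `[s, T]) (f x * \int[mu]_(y in `[x, T]) g y) =
  \int[mu]_(y in `[s, T]) ((\int[mu]_(x in `[s, y]) f x) * g y).
Proof.
move=> fi gi; have restrict_integrable h : mu.-integrable `[s, T] (EFin \o h) ->
    mu.-integrable setT (EFin \o (h \_ `[s, T])).
  by move=> hi; rewrite -restrict_EFin; apply/integrable_restrict;
    rewrite ?setTI.
have := Rintegral_triangle
  (restrict_integrable f fi) (restrict_integrable g gi).
have cut_left x : `[s, T]%classic x -> `[x, +oo[ `&` `[s, T] = `[x, T]%classic.
  move=> /=; rewrite in_itv/= => xI; apply/seteqP; split=> y /=;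
    rewrite !in_itv/=; last by lra.
  by move=> [/andP[-> _] /andP[]].
have cut_right x : `[s, T]%classic x -> `]-oo, x] `&` `[s, T] = `[s, x]%classic.
  move=> /=; rewrite in_itv/= => xI; apply/seteqP; split=> y /=;
    rewrite !in_itv/=; last by lra.
  by move=> [-> /andP[->]].
move=> triangle; rewrite [RHS]Rintegral_mkcond [LHS]Rintegral_mkcond.
transitivity (\int[mu]_x
    ((f \_ `[s, T]) x * \int[mu]_(y in `[x, +oo[) (g \_ `[s, T]) y)).
  apply: eq_Rintegral => x _; rewrite !patchE; case: ifPn => [|_];
    last by rewrite mul0r.
  by rewrite inE => xI; rewrite -Rintegral_mkcondr cut_left.
rewrite triangle; apply: eq_Rintegral => x _; rewrite !patchE.
case: ifPn => [|_]; last by rewrite mulr0.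
by rewrite inE => xI; rewrite -Rintegral_mkcondr cut_right.
Qed.

Lemma integrable_continuous_mul f h s T : s <= T ->
  {within `[s, T], continuous h} ->
  mu.-integrable `[s, T] (EFin \o f) ->
  mu.-integrable `[s, T] (EFin \o (fun t => h t * f t)).
Proof.
move=> sT ch fi; have [M _ hM] := within_continuous_bounded sT ch.
have [/measurable_EFinP mh _] :=
  integrableP _ _ _ (integrable_within_continuous ch).
exact: (integrable_bounded_mul (measurable_segment s T) mh hM fi).
Qed.

Lemma Rintegration_by_parts_ac f g s T : s <= T ->
  mu.-integrable `[s, T] (EFin \o f) ->
  mu.-integrable `[s, T] (EFin \o g) ->
  \int[mu]_(t in `[s, T]) ((\int[mu]_(x in `[s, t]) f x) * g t) +
  \int[mu]_(t in `[s, T]) ((\int[mu]_(x in `[s, t]) g x) * f t) =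
  (\int[mu]_(t in `[s, T]) f t) * \int[mu]_(t in `[s, T]) g t.
Proof.
move=> sT fi gi; pose G t := \int[mu]_(x in `[s, t]) g x.
have cG : {within `[s, T], continuous G}.
  by exact: parameterized_integral_continuous.
have Gfi := integrable_continuous_mul sT cG fi.
have cfi := integrableZl (measurable_segment s T) (G T) fi.
rewrite -Rintegral_triangle_itv//.
have -> : \int[mu]_(t in `[s, T]) (f t * \int[mu]_(x in `[t, T]) g x) =
    \int[mu]_(t in `[s, T]) (G T * f t - G t * f t).
  apply: eq_Rintegral => t; rewrite inE/= in_itv/= => /andP[st tT].
  by rewrite /G (Rintegral_itv_cat st tT gi); ring.
by rewrite RintegralB// RintegralZl// subrK mulrC.
Qed.

End Segment.

Section WeakForm.
Variable R : realType.
Local Notation mu := (@lebesgue_measure R).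
Local Notation segment s t := (`[s, t]%classic : set (measurableTypeR R)).
Variables (p L : R).
Hypotheses (p_gt0 : 0 < p) (L_gt0 : 0 < L).
Implicit Types (F g h u phi psi : R -> R) (m lam M : R).

Lemma W1p0_continuous u g : W1p0 p L u g -> {within `[0, L], continuous u}.
Proof.
move=> [gi _ uE _]; have cu := parameterized_integral_continuous (ltW L_gt0) gi.
by apply: subspace_eq_continuous cu => t; rewrite inE/= in_itv/= => /uE.
Qed.

Lemma W1p0_bounded psi M :
  measurable_fun (segment 0 L) psi ->
  (forall t, `[0, L]%classic t -> `|psi t| <= M) ->
  \int[mu]_(t in `[0, L]) psi t = 0 ->
  W1p0 p L (fun t => \int[mu]_(s in `[0, t]) psi s) psi.
Proof.
move=> mpsi psi_le psi0.
have L_fin : (mu `[0%R, L] < +oo)%E.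
  by rewrite lebesgue_measure_itv/= lte_fin L_gt0 ltry.
have mI := measurable_segment 0 L.
split=> //; first exact: (bounded_integrable mI L_fin mpsi psi_le).
apply: (bounded_integrable mI L_fin (M := M `^ p)).
  have mpow := continuous_measurable_fun (continuous_normr_powR p_gt0).
  exact: (measurableT_comp mpow mpsi).
move=> t /psi_le psi_t; rewrite ger0_norm ?powR_ge0//.
by apply: ge0_ler_powR; rewrite ?nnegrE ?(ltW p_gt0)// (le_trans _ psi_t).
Qed.

(* The test functions are the primitives of mean-zero functions; by parts, the
   weak equation makes [F + lam * \int_0^t h] orthogonal to the latter. *)
Lemma weak_form_primitive F h lam : mu.-integrable `[0, L] (EFin \o F) ->
  mu.-integrable `[0, L] (EFin \o h) ->
  (forall phi psi, W1p0 p L phi psi -> \int[mu]_(t in `[0, L]) (F t * psi t) =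
    lam * \int[mu]_(t in `[0, L]) (h t * phi t)) ->
  exists m, ae_eq mu (segment 0 L) F
    (fun t => m - lam * \int[mu]_(s in `[0, t]) h s).
Proof.
move=> Fi hi weak; pose H t := \int[mu]_(s in `[0, t]) h s.
have cH : {within `[0, L], continuous H}.
  by exact: (parameterized_integral_continuous (ltW L_gt0) hi).
have mI := measurable_segment 0 L.
have Hi : mu.-integrable `[0, L] (EFin \o (fun t => lam * H t)).
  exact: (integrableZl mI lam (integrable_within_continuous cH)).
pose v t := F t + lam * H t.
have vi : mu.-integrable `[0, L] (EFin \o v) by exact: (integrableD mI Fi Hi).
have muL : mu (segment 0 L) = L%:E.
  by rewrite /= lebesgue_measure_itv/= lte_fin L_gt0 oppr0 adde0.
pose m := average mu (segment 0 L) v; exists m.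
have : ae_eq mu (segment 0 L) v (cst m).
  apply: du_bois_reymond => //;
    rewrite /= ?muL ?lte_fin ?ltry// => psi mpsi [M psi_le] psi0.
  have psi_test := W1p0_bounded mpsi psi_le psi0.
  have psii : mu.-integrable `[0, L] (EFin \o psi) by case: psi_test.
  have psiFi := integrable_bounded_mul mI mpsi psi_le Fi.
  have Hpsii := integrable_continuous_mul (ltW L_gt0) cH psii.
  transitivity (\int[mu]_(t in `[0, L]) (psi t * F t + lam * (H t * psi t))).
    by apply: eq_Rintegral => t _; rewrite /v; ring.
  rewrite RintegralD//; last exact: (integrableZl mI lam Hpsii).
  under eq_Rintegral do rewrite mulrC.
  rewrite RintegralZl// (weak _ _ psi_test) -mulrDr.
  have parts := Rintegration_by_parts_ac (ltW L_gt0) hi psii.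
  under [X in lam * (X + _)]eq_Rintegral do rewrite mulrC.
  by rewrite addrC parts psi0 !mulr0.
by apply: filterS => t /= vm tI; rewrite -vm// addrK.
Qed.

Lemma primitive_weak_form h m lam phi psi :
  mu.-integrable `[0, L] (EFin \o h) ->
  W1p0 p L phi psi ->
  \int[mu]_(t in `[0, L]) ((m - lam * \int[mu]_(s in `[0, t]) h s) * psi t) =
  lam * \int[mu]_(t in `[0, L]) (h t * phi t).
Proof.
move=> hi test; have [psii _ phiE phiL] := test.
have mI := measurable_segment 0 L.
pose H t := \int[mu]_(s in `[0, t]) h s.
have cH := parameterized_integral_continuous (ltW L_gt0) hi.
have Hpsii := integrable_continuous_mul (ltW L_gt0) cH psii.
have psi0 : \int[mu]_(s in `[0, L]) psi s = 0 by rewrite -phiE// lexx ltW.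
have -> : \int[mu]_(t in `[0, L]) (h t * phi t) =
    \int[mu]_(t in `[0, L]) ((\int[mu]_(s in `[0, t]) psi s) * h t).
  by apply: eq_Rintegral => t; rewrite inE/= in_itv/= => tI;
    rewrite phiE// mulrC.
have /eqP := Rintegration_by_parts_ac (ltW L_gt0) hi psii.
rewrite psi0 mulr0 addrC addr_eq0 => /eqP ->.
transitivity (\int[mu]_(t in `[0, L]) (m * psi t - lam * (H t * psi t))).
  by apply: eq_Rintegral => t _; rewrite /H; ring.
have mpsii := integrableZl mI m psii; have lHpsii := integrableZl mI lam Hpsii.
by rewrite RintegralB// !RintegralZl// psi0 mulr0 sub0r mulrN.
Qed.

End WeakForm.

Section EigenOde.
Variable R : realType.
Local Notation mu := (@lebesgue_measure R).
Local Notation segment s t := (`[s, t]%classic : set (measurableTypeR R)).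
Variable p : R.
Hypothesis p_gt1 : 1 < p.
Let p_gt0 : 0 < p. Proof. exact: lt_trans p_gt1. Qed.
Let q_gt1 := conj_exp_gt1 p_gt1.
Implicit Types (f g u w U W : R -> R) (s t x L T a b c d k m lam : R).

Definition eigen_ode a b lam s T u w :=
  hamiltonian_sol (flux_ab (conj_exp p) a^-1 b^-1)
    (fun x => lam * flux_ab p 1 1 x) s T u w.

Lemma powRB1_le x : 0 <= x -> x `^ (p - 1) <= 1 + x `^ p.
Proof.
move=> x0; have [x1|/ltW x1] := leP x 1.
  have pB1 : 0 <= p - 1 by rewrite subr_ge0 ltW.
  have := ge0_ler_powR pB1 x0 ler01 x1; rewrite powR1 => /le_trans; apply.
  by rewrite lerDl powR_ge0.
by rewrite (@le_trans _ _ (x `^ p)) ?lerDr ?ler_powR// gerBl.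
Qed.

Lemma integrable_flux a b L g : mu.-integrable `[0, L] (EFin \o g) ->
  mu.-integrable `[0, L] (EFin \o (fun t => `|g t| `^ p)) ->
  mu.-integrable `[0, L] (EFin \o (fun t => flux_ab p a b (g t))).
Proof.
move=> gi gpi; have mI := measurable_segment 0 L.
have i1 : mu.-integrable `[0, L] (EFin \o cst 1).
  by apply: integrable_within_continuous; apply: continuous_subspaceT => x;
    exact: cvg_cst.
have bound_i : mu.-integrable `[0, L]
    (EFin \o (fun t => (a `^ p + b `^ p) * (1 + `|g t| `^ p))).
  exact: (integrableZl mI (a `^ p + b `^ p) (integrableD mI i1 gpi)).
apply: le_integrable bound_i => //.
  have [/measurable_EFinP mg _] := integrableP _ _ _ gi.
  apply/measurable_EFinP.
  have mflux := continuous_measurable_fun (continuous_flux p_gt1 (a:=a) (b:=b)).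
  exact: (measurableT_comp mflux mg).
move=> t _; rewrite lee_fin; apply: le_trans (flux_le_norm p_gt1 a b (g t)) _.
apply: le_trans (ler_norm _).
by rewrite ler_wpM2l ?addr_ge0 ?powR_ge0// powRB1_le.
Qed.

Lemma eigen_ode_continuous a b lam s T u w : eigen_ode a b lam s T u w ->
  {within `[s, T], continuous (fun t => flux_ab p 1 1 (u t))} /\
  {within `[s, T], continuous (fun t => flux_ab (conj_exp p) a^-1 b^-1 (w t))}.
Proof.
move=> sol; split; apply: within_continuous_pointwise => t /sol[du dw].
  exact: continuous_flux_comp du.
exact: continuous_flux_comp dw.
Qed.

Lemma eigen_ode_primitive a b lam s t u w : s <= t ->
  eigen_ode a b lam s t u w ->
  u t - u s = \int[mu]_(x in `[s, t]) flux_ab (conj_exp p) a^-1 b^-1 (w x) /\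
  w s - w t = lam * \int[mu]_(x in `[s, t]) flux_ab p 1 1 (u x).
Proof.
move=> st sol; have [cfu cGw] := eigen_ode_continuous sol; split.
  by apply/esym/(Rintegral_is_derive st _ cGw) => x /sol[].
rewrite -RintegralZl//; last exact: integrable_within_continuous.
have clfu : {within `[s, t], continuous (fun x => lam * flux_ab p 1 1 (u x))}.
  by move=> x; apply: cvgMl_tmp; exact: cfu.
have -> : w s - w t = - w t - - w s by rewrite opprK addrC.
apply/esym/(Rintegral_is_derive (F := fun x => - w x) st _ clfu).
by move=> x /sol[_ dw]; apply: (is_derive_eq (is_deriveN dw)); rewrite opprK.
Qed.

Section Weak.
Variables a b L lam : R.
Hypotheses (a_gt0 : 0 < a) (b_gt0 : 0 < b) (L_gt0 : 0 < L).
Let G := flux_ab (conj_exp p) a^-1 b^-1.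
Let f x := flux_ab p 1 1 x.

Lemma weak_eigen_ode u : weak_eigen_sol (flux_ab p a b) p L lam u ->
  exists U W, [/\ forall t, 0 <= t <= L -> u t = U t,
    eigen_ode a b lam 0 L U W, U 0 = 0 & U L = 0].
Proof.
move=> [g [uW weak]]; have [gi gpi uE uL] := uW.
have cfu : {within `[0, L], continuous (f \o u)}.
  apply: within_continuous_comp (W1p0_continuous L_gt0 uW).
  by move=> x _; exact: continuous_flux.
have [|m gm] :=
  weak_form_primitive (lam := lam) p_gt0 L_gt0 (integrable_flux a b gi gpi)
    (integrable_within_continuous cfu).
  move=> phi psi /weak ->; congr (_ * _); apply: eq_Rintegral => t _.
  by rewrite /rhs_p -/(flux_p p (u t)) flux_pE.
have [P P_primitive] := continuous_primitive (ltW L_gt0) cfu.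
pose W t := m - lam * P t.
have W' t : 0 <= t <= L -> is_derive t 1 W (- (lam * f (u t))).
  move=> /P_primitive[dP _].
  have dW := is_deriveB (is_derive_cst m t 1) (is_deriveZ lam dP).
  by apply: (is_derive_eq dW); rewrite sub0r.
have cGW : {within `[0, L], continuous (G \o W)}.
  apply: within_continuous_pointwise => t /W' dW.
  exact: continuous_flux_comp dW.
have [U U_primitive] := continuous_primitive (ltW L_gt0) cGW.
have gGW t : 0 <= t <= L ->
  \int[mu]_(s in `[0, t]) g s = \int[mu]_(s in `[0, t]) (G \o W) s.
  move=> /andP[t0 tL].
  have gGW_ae : ae_eq mu (segment 0 t) g (G \o W).
    apply: filterS gm => s /=; rewrite !in_itv/= => gms sI.
    have sL : 0 <= s <= L by lra.
    by rewrite -(fluxK p_gt1 a_gt0 b_gt0 (g s)) gms// /W (P_primitive s sL).2.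
  apply: (Rintegral_ae_eq (measurable_segment 0 t) _ _ gGW_ae).
    exact: integrable_itvS gi.
  exact: integrable_itvS (integrable_within_continuous cGW).
have uU t : 0 <= t <= L -> u t = U t.
  by move=> tI; rewrite uE// gGW// (U_primitive t tI).2.
exists U, W; split=> //.
- move=> t tI; split; first exact: (U_primitive t tI).1.
  by rewrite -uU//; exact: W'.
- by rewrite (U_primitive 0 _).2 ?lexx ?ltW// set_itv1 Rintegral_set1.
- by rewrite -uU// lexx ltW.
Qed.

Lemma eigen_ode_weak u U W : (forall t, 0 <= t <= L -> u t = U t) ->
  eigen_ode a b lam 0 L U W -> U 0 = 0 -> U L = 0 ->
  weak_eigen_sol (flux_ab p a b) p L lam u.
Proof.
move=> uU sol U0 UL; have [cfU cGW] := eigen_ode_continuous sol.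
have primitive t : 0 <= t <= L -> U t = \int[mu]_(s in `[0, t]) G (W s) /\
    W t = W 0 - lam * \int[mu]_(s in `[0, t]) f (U s).
  move=> /andP[t0 tL].
  have [<- <-] := eigen_ode_primitive t0 (hamiltonian_solS (lexx 0) tL sol).
  by rewrite U0 subr0 subKr.
exists (fun t => G (W t)); split; first split.
- exact: integrable_within_continuous.
- apply: integrable_within_continuous.
  apply: (@within_continuous_comp _ _ _ _ (fun t => G (W t))
    (fun x => `|x| `^ p)) cGW => x _.
  exact: continuous_normr_powR.
- by move=> t tI; rewrite uU// (primitive t tI).1.
- by rewrite uU// lexx ltW.
move=> phi psi test.
transitivity (\int[mu]_(t in `[0, L])
    ((W 0 - lam * \int[mu]_(s in `[0, t]) f (U s)) * psi t)).
  apply: eq_Rintegral => t; rewrite inE/= in_itv/= => tI.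
  by rewrite /G flux_invK// -(primitive t tI).2.
have fUi := integrable_within_continuous cfU.
rewrite (primitive_weak_form L_gt0 _ _ fUi test); congr (_ * _).
apply: eq_Rintegral => t; rewrite inE/= in_itv/= => tI.
by rewrite uU// /rhs_p -/(flux_p p (U t)) flux_pE.
Qed.

End Weak.

End EigenOde.

Section EigenOdeTransformations.
Variables (R : realType) (p : R).
Hypothesis p_gt1 : 1 < p.
Let p_gt0 : 0 < p. Proof. exact: lt_trans p_gt1. Qed.
Let q_gt1 := conj_exp_gt1 p_gt1.
Implicit Types (f g u w U W : R -> R) (s t x L T a b c d k lam : R).

Lemma eigen_ode_scale a b lam s T u w c k d : 0 <= c -> 0 <= k ->
  eigen_ode p a b lam (k * s + d) (k * T + d) u w ->
  eigen_ode p a b (k `^ p * lam) s T (fun t => c * u (k * t + d))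
    (fun t => (c * k) `^ (p - 1) * w (k * t + d)).
Proof.
move=> c0 k0 sol t /andP[st tT].
have [|du dw] := sol (k * t + d); first by rewrite !lerD2r !ler_wpM2l.
have ck0 : 0 <= c * k by exact: mulr_ge0.
split.
  apply: (is_derive_eq (is_deriveZ c (is_derive_comp_affine du))).
  rewrite flux_homo ?powR_ge0// conj_expB1// -powRrM divff ?gt_eqF ?subr_gt0//.
  by rewrite powRr1// -mulrA.
apply: (is_derive_eq (is_deriveZ _ (is_derive_comp_affine dw))).
rewrite /GRing.scale/= flux_homo// powRM// -(mulr_powRB1 k0 p_gt0).
by ring.
Qed.

Lemma eigen_ode_opp a b lam s T u w : eigen_ode p a b lam s T u w ->
  eigen_ode p b a lam s T (fun t => - u t) (fun t => - w t).
Proof.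
move=> sol t tI; have [du dw] := sol t tI.
by rewrite !fluxN mulrN; split; exact: is_deriveN.
Qed.

Lemma eigen_ode_reflect a b lam s T u w : eigen_ode p a b lam s T u w ->
  eigen_ode p b a lam s T (fun t => u (s + T - t)) (fun t => - w (s + T - t)).
Proof.
move=> sol t tI; have [|du dw] := sol (s + T - t); first lra.
split; first by rewrite fluxN; exact: is_derive_comp_reflect.
by have := is_deriveN (is_derive_comp_reflect dw); rewrite opprK.
Qed.

Lemma eigen_ode_ge0 a b lam s T u w : 0 < a ->
  (forall t, s <= t <= T -> 0 <= w t) -> eigen_ode p 1 1 lam s T u w ->
  eigen_ode p a b (a `^ p * lam) s T u (fun t => a `^ p * w t).
Proof.
move=> a0 w_ge0 sol t tI; have [du dw] := sol t tI; have wt := w_ge0 t tI.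
split; last first.
  by apply: (is_derive_eq (is_deriveZ (a `^ p) dw));
    rewrite /GRing.scale/= mulrN mulrA.
apply: (is_derive_eq du); rewrite !flux_ge0E ?mulr_ge0 ?powR_ge0//.
rewrite invr1 powR1 mul1r powRM ?powR_ge0// conj_expB1// -powRrM mulrA.
by rewrite -powRM ?invr_ge0 ?(ltW a0)// mulVf ?gt_eqF// powR1 mul1r.
Qed.

Lemma eigen_ode_le0 a b lam s T u w : 0 < b ->
  (forall t, s <= t <= T -> w t <= 0) -> eigen_ode p 1 1 lam s T u w ->
  eigen_ode p a b (b `^ p * lam) s T u (fun t => b `^ p * w t).
Proof.
move=> b0 w_le0 /eigen_ode_opp/(eigen_ode_ge0 a b0) sol.
have /sol/eigen_ode_opp : forall t, s <= t <= T -> 0 <= - w t.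
  by move=> t tI; rewrite oppr_ge0 w_le0.
congr eigen_ode; apply/funext => t; first by rewrite opprK.
by rewrite mulrN opprK.
Qed.

Lemma eigen_ode_unique a b lam s T u1 w1 u2 w2 : 0 < a -> 0 < b -> 0 < lam ->
  eigen_ode p a b lam s T u1 w1 -> eigen_ode p a b lam s T u2 w2 ->
  u1 s = u2 s -> w1 s = w2 s ->
  forall t, s <= t <= T -> u1 t = u2 t /\ w1 t = w2 t.
Proof.
move=> a0 b0 lam0; apply: hamiltonian_unique.
  by apply: restoring_flux; rewrite ?invr_gt0.
by apply: restoring_forceZ lam0 _; exact: restoring_flux.
Qed.

Lemma eigen_ode_zero a b lam s T : eigen_ode p a b lam s T (fun=> 0) (fun=> 0).
Proof.
by move=> t _; rewrite !flux0// mulr0 oppr0; split; exact: is_derive_cst.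
Qed.

(* [u w] is nondecreasing for [lam <= 0] and vanishes at both ends. *)
Lemma eigen_ode_nonpos a b lam L u w : 0 < a -> 0 < b ->
  lam <= 0 -> eigen_ode p a b lam 0 L u w -> u 0 = 0 -> u L = 0 ->
  forall t, 0 <= t <= L -> u t = 0.
Proof.
move=> a0 b0 lam_le0 sol u0 uL.
pose G := flux_ab (conj_exp p) a^-1 b^-1.
have GM_ge0 x : 0 <= G x * x.
  have [->|x0] := eqVneq x 0; first by rewrite mulr0.
  by rewrite ltW// flux_mul_gt0// invr_gt0.
have fM_ge0 x : 0 <= flux_ab p 1 1 x * x.
  have [->|x0] := eqVneq x 0; first by rewrite mulr0.
  by rewrite ltW// flux_mul_gt0.
have uw_le s t : 0 <= s -> s <= t -> t <= L -> u s * w s <= u t * w t.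
  move=> s0 st tL.
  apply: (@is_derive_ge0_le _ (fun t => u t * w t)
    (fun t => - lam * (flux_ab p 1 1 (u t) * u t) + G (w t) * w t)) => // x xI.
    have [|du dw] := sol x; first lra.
    by apply: (is_derive_eq (is_deriveM du dw)); rewrite /GRing.scale/= /G;
      ring.
  by rewrite addr_ge0// mulr_ge0// oppr_ge0.
have uw0 t : 0 <= t <= L -> u t * w t = 0.
  move=> /andP[t0 tL]; apply/eqP; rewrite eq_le.
  by move: (uw_le 0 t) (uw_le t L); rewrite u0 uL !mul0r => -> // ->.
have uGw0 t : 0 <= t <= L -> u t * G (w t) = 0.
  move=> /uw0/eqP; rewrite mulf_eq0 => /orP[/eqP->|/eqP->];
    first by rewrite mul0r.
  by rewrite /G flux0// mulr0.
move=> t /andP[t0 tL]; suff : 0 = u t * u t.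
  by move/esym/eqP; rewrite mulf_eq0 orbb => /eqP.
rewrite -[LHS](mul0r (u 0)) -[X in X * _]u0.
apply: (@is_derive0_eq _ (fun t => u t * u t)) => // x xI.
have [|du _] := sol x; first lra.
by apply: (is_derive_eq (is_deriveM du du));
  rewrite /GRing.scale/= uGw0 ?addr0//; lra.
Qed.

End EigenOdeTransformations.

Section PrincipalOrbit.
Variables (R : realType) (p : R).
Hypothesis p_gt1 : 1 < p.
Let q_gt1 := conj_exp_gt1 p_gt1.
Implicit Types (U W : R -> R) (s t x lam : R).

Record principal_orbit lam U W : Prop := PrincipalOrbit {
  orbit_ode : eigen_ode p 1 1 lam 0 1 U W;
  orbit0 : U 0 = 0;
  orbit1 : U 1 = 0;
  orbit_gt0 : forall t, 0 < t < 1 -> 0 < U t }.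

Lemma principal_orbit_reflect lam U W : principal_orbit lam U W ->
  principal_orbit lam (fun t => U (1 - t)) (fun t => - W (1 - t)).
Proof.
move=> [sol U0 U1 U_gt0]; split; rewrite ?subr0 ?subrr//; last first.
  by move=> t tI; apply: U_gt0; lra.
by have := eigen_ode_reflect sol; rewrite add0r.
Qed.

Lemma orbit_lam_gt0 lam U W : principal_orbit lam U W -> 0 < lam.
Proof.
move=> [sol U0 U1 U_gt0]; rewrite ltNge; apply/negP => lam_le0.
have := eigen_ode_nonpos p_gt1 ltr01 ltr01 lam_le0 sol U0 U1 (t := 2^-1).
by have := U_gt0 2^-1; lra.
Qed.

Lemma orbit_flux_nincr lam U W s t : principal_orbit lam U W ->
  0 <= s -> s <= t -> t <= 1 -> W t <= W s.
Proof.
move=> orb s0 st t1; have [sol U0 U1 U_gt0] := orb; rewrite -lerN2.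
apply: (@is_derive_ge0_le _ (fun x => - W x)
  (fun x => lam * flux_ab p 1 1 (U x))) => // x xI.
  have [|_ dW] := sol x; first lra.
  by apply: (is_derive_eq (is_deriveN dW)); rewrite opprK.
have U_ge0 : 0 <= U x.
  have [->|x0] := eqVneq x 0; first by rewrite U0.
  have [->|x1] := eqVneq x 1; first by rewrite U1.
  by rewrite ltW// U_gt0// !lt_neqAle x1 eq_sym x0/=; lra.
by rewrite flux_ge0E// mulr_ge0 ?(ltW (orbit_lam_gt0 orb))// mulr_ge0 ?powR_ge0.
Qed.

Lemma orbit_flux0_gt0 lam U W : principal_orbit lam U W -> 0 < W 0.
Proof.
move=> orb; have [sol U0 _ U_gt0] := orb; rewrite ltNge; apply/negP => W0.
suff : - U 0 <= - U 2^-1 by have := U_gt0 2^-1; rewrite U0; lra.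
apply: (@is_derive_ge0_le _ (fun x => - U x)
  (fun x => - flux_ab (conj_exp p) 1^-1 1^-1 (W x))) => [|x xI|x xI]; first lra.
  by have [|dU _] := sol x; [lra|exact: is_deriveN].
have Wx : W x <= 0 by apply: le_trans (orbit_flux_nincr orb _ _ _) W0; lra.
by rewrite -fluxN flux_ge0E ?oppr_ge0// mulr_ge0 ?powR_ge0.
Qed.

Lemma orbit_flux1 lam U W : principal_orbit lam U W -> W 1 = - W 0.
Proof.
move=> orb; have [sol U0 U1 _] := orb; have W0 := orbit_flux0_gt0 orb.
have := orbit_flux0_gt0 (principal_orbit_reflect orb).
rewrite subr0 oppr_gt0 => W1.
have dEF x :
    is_derive x 1 (fun x => lam * energy p 1 1 x) (lam * flux_ab p 1 1 x).
  by apply: is_deriveZ; exact: is_derive_energy.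
have dEG x : is_derive x 1 (energy (conj_exp p) 1^-1 1^-1)
    (flux_ab (conj_exp p) 1^-1 1^-1 x) by exact: is_derive_energy.
have := hamiltonian_conserved dEG dEF ler01 sol.
rewrite U0 U1 => /addIr; rewrite invr1 !energy_symE// => /mulfI.
have q_gt0 : 0 < conj_exp p by exact: lt_trans q_gt1.
rewrite invr_eq0 gt_eqF// => /(_ isT)/(powR_injective q_gt0).
by rewrite !nnegrE !normr_ge0 ltr0_norm// gtr0_norm// => /(_ isT isT) <-;
  rewrite opprK.
Qed.

Lemma orbit_flux_antisym lam U W t : principal_orbit lam U W -> 0 <= t <= 1 ->
  W t = - W (1 - t).
Proof.
move=> orb tI; have [sol U0 U1 _] := orb.
have [sol' _ _ _] := principal_orbit_reflect orb.
have [||_ ->//] :=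
  eigen_ode_unique p_gt1 ltr01 ltr01 (orbit_lam_gt0 orb) sol sol' _ _ tI.
  by rewrite subr0 U0 U1.
by rewrite subr0 (orbit_flux1 orb) opprK.
Qed.

Lemma orbit_flux_half lam U W : principal_orbit lam U W -> W 2^-1 = 0.
Proof.
move=> orb; have := @orbit_flux_antisym lam U W 2^-1 orb.
by rewrite (_ : 1 - 2^-1 = 2^-1); lra.
Qed.

Lemma orbit_flux_ge0 lam U W t : principal_orbit lam U W -> 0 <= t <= 2^-1 ->
  0 <= W t.
Proof.
by move=> orb tI; rewrite -(orbit_flux_half orb);
  apply: (orbit_flux_nincr orb); lra.
Qed.

Lemma orbit_flux_le0 lam U W t : principal_orbit lam U W -> 2^-1 <= t <= 1 ->
  W t <= 0.
Proof.
by move=> orb tI; rewrite -(orbit_flux_half orb);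
  apply: (orbit_flux_nincr orb); lra.
Qed.

End PrincipalOrbit.

Section Gluing.
Variable R : realType.
Implicit Types (f G F u w : R -> R) (s t x m d T : R).

Lemma hamiltonian_sol_glue G F s m T u1 w1 u2 w2 :
  hamiltonian_sol G F s m u1 w1 -> hamiltonian_sol G F m T u2 w2 ->
  u1 m = u2 m -> w1 m = w2 m ->
  hamiltonian_sol G F s T (fun t => if t < m then u1 t else u2 t)
    (fun t => if t < m then w1 t else w2 t).
Proof.
move=> sol1 sol2 um wm t tI; have ifE (v1 v2 : R -> R) : v1 m = v2 m ->
    t <= m -> (if t < m then v1 t else v2 t) = v1 t.
  by move=> vm tm; case: ltgtP tm => // ->.
split; apply: is_derive_if => //.
- by move=> tm; rewrite (ifE w1 w2)//; have [|] := sol1 t; first lra.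
- by move=> mt; rewrite ltNge mt/=; have [|] := sol2 t; first lra.
- by move=> tm; rewrite (ifE u1 u2)//; have [|] := sol1 t; first lra.
- by move=> mt; rewrite ltNge mt/=; have [|] := sol2 t; first lra.
Qed.

Lemma hamiltonian_sol_shift G F s T d u w :
  hamiltonian_sol G F (s + d) (T + d) u w ->
  hamiltonian_sol G F s T (fun t => u (t + d)) (fun t => w (t + d)).
Proof.
move=> sol t /andP[st tT]; have [|du dw] := sol (t + d);
  first by rewrite !lerD2r st.
by split; exact: is_derive_comp_shift.
Qed.

Section Periodize.
Variable T : R.
Hypothesis T_gt0 : 0 < T.

Definition periodize f t := f (t - T * (Num.floor (t / T))%:~R).

Lemma periodize_itv t : 0 <= t - T * (Num.floor (t / T))%:~R < T.
Proof.
have := floor_le (t / T); have := floorD1_gt (t / T).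
rewrite intrD ler_pdivlMr// ltr_pdivrMr// mulrDl mul1r mulrC.
by move=> lt_t le_t; rewrite subr_ge0 ltrBlDl le_t.
Qed.

Lemma periodizeE f t (n : int) : T * n%:~R <= t < T * n%:~R + T ->
  periodize f t = f (t - T * n%:~R).
Proof.
move=> tI; rewrite /periodize (@floor_def _ (t / T) n)//.
by rewrite intrD ler_pdivlMr// ltr_pdivrMr// mulrDl mul1r mulrC.
Qed.

Lemma is_derive_periodize f (df : R -> R) t :
  (forall x, 0 <= x <= T -> is_derive x 1 f (df x)) ->
  f 0 = f T -> df 0 = df T ->
  is_derive t 1 (periodize f) (periodize df t).
Proof.
move=> f' f0T df0T; rewrite [periodize df t]/periodize; have := periodize_itv t.
move: (Num.floor (t / T)) => n; set m := T * n%:~R => tm.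
have f'm : is_derive t 1 (fun y => f (y - m)) (df (t - m)).
  by apply: is_derive_comp_shift; apply: f'; lra.
have f'T : t <= m -> is_derive t 1 (fun y => f (y + (T - m))) (df (t - m)).
  move=> t_le; have tE : t = m.
    by apply/eqP; rewrite eq_le t_le -subr_ge0; case/andP: tm.
  rewrite tE subrr df0T; apply: is_derive_comp_shift.
  by rewrite addrC subrK; apply: f'; rewrite lexx ltW.
have glued : is_derive t 1
    (fun y => if y < m then f (y + (T - m)) else f (y - m)) (df (t - m)).
  by apply: is_derive_if => // _; rewrite subrr addrC subrK f0T.
apply: near_eq_is_derive glued; near=> y.
have ym : m - T < y < m + T.
  by apply/andP; split; near: y; [apply: lt_nbhsr|apply: lt_nbhsl]; lra.
case: ltP => y_m; last by rewrite (@periodizeE f y n)// -/m; lra.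
rewrite (@periodizeE f y (n - 1)) intrB mulrBr mulr1 -/m; last by lra.
by congr f; ring.
Unshelve. all: by end_near. Qed.

Lemma hamiltonian_sol_periodize G F s S u w : hamiltonian_sol G F 0 T u w ->
  u 0 = u T -> w 0 = w T -> hamiltonian_sol G F s S (periodize u) (periodize w).
Proof.
move=> sol u0T w0T t _; split.
  apply: (@is_derive_periodize u (fun x => G (w x))); rewrite ?w0T// => x xI.
  by have [] := sol x xI.
apply: (@is_derive_periodize w (fun x => - F (u x))); rewrite ?u0T// => x xI.
by have [] := sol x xI.
Qed.

End Periodize.
End Gluing.

Section Waves.
Variables (R : realType) (p : R).
Hypothesis p_gt1 : 1 < p.
Let p_gt0 : 0 < p. Proof. exact: lt_trans p_gt1. Qed.
Implicit Types (f g u w U W : R -> R) (s t x T a b c d m lam : R).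

Lemma t0_itv a b : 0 < a -> 0 < b -> 0 < t0 a b < 1.
Proof.
move=> a0 b0; have ab0 := addr_gt0 a0 b0.
by rewrite /t0 divr_gt0//= ltr_pdivrMr// mul1r ltrDl.
Qed.

Lemma t0_swap a b : 0 < a -> 0 < b -> t0 b a = 1 - t0 a b.
Proof.
by move=> a0 b0; rewrite /t0 (addrC b a); field; rewrite gt_eqF ?addr_gt0.
Qed.

Lemma phi_ab_minusE f a b t : 0 < a -> 0 < b ->
  phi_ab_minus f a b t = - phi_ab_plus f b a t.
Proof.
move=> a0 b0; rewrite /phi_ab_minus /phi_ab_plus (t0_swap a0 b0) subKr.
have -> : t + 1 - 2 * (1 - t0 a b) = t + 2 * t0 a b - 1 by ring.
by case: ifP.
Qed.

(* The position on the orbit at time [t]: a half-orbit whose slope has weight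
   [c] is run at speed [(a + b) / 2 / c]. *)
Definition phase a b t : R := let m := (a + b) / 2 in
  if t < t0 a b then m / a * t else m / b * t + (1 - m / b).

Definition wave_flux W a b t : R :=
  ((a + b) / 2) `^ (p - 1) * ((if t < t0 a b then a else b) * W (phase a b t)).

Lemma eigen_ode_reweight a b c m d lam s T U W : 0 < c -> 0 < m ->
  eigen_ode p a b (c `^ p * lam) (m / c * s + d) (m / c * T + d)
    U (fun t => c `^ p * W t) ->
  eigen_ode p a b (m `^ p * lam) s T (fun t => U (m / c * t + d))
    (fun t => m `^ (p - 1) * (c * W (m / c * t + d))).
Proof.
move=> c0 m0 /(eigen_ode_scale p_gt1 ler01 (ltW (divr_gt0 m0 c0))).
rewrite mulrA -powRM ?(ltW c0) ?ltW ?divr_gt0// divfK ?gt_eqF// mul1r.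
congr eigen_ode; apply/funext => t; rewrite ?mul1r//.
rewrite -(mulr_powRB1 (ltW c0) p_gt0) !mulrA; congr (_ * _).
by rewrite mulrAC -powRM ?(ltW c0) ?ltW ?divr_gt0// divfK ?gt_eqF.
Qed.

Section PositiveWave.
Variables a b : R.
Hypotheses (a_gt0 : 0 < a) (b_gt0 : 0 < b).
Let m := (a + b) / 2.
Let m_gt0 : 0 < m. Proof. by rewrite divr_gt0 ?addr_gt0. Qed.
Let aN : a != 0. Proof. by rewrite gt_eqF. Qed.
Let bN : b != 0. Proof. by rewrite gt_eqF. Qed.
Let abN : a + b != 0. Proof. by rewrite gt_eqF ?addr_gt0. Qed.

Lemma phi_ab_plusE f t : phi_ab_plus f a b t = f (phase a b t).
Proof.
rewrite /phi_ab_plus /phase /t0; case: ifP => _; congr f; field;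
  by rewrite ?abN ?aN ?bN.
Qed.

Lemma phase0 : phase a b 0 = 0.
Proof.
by have /andP[t0_gt0 _] := t0_itv a_gt0 b_gt0; rewrite /phase t0_gt0 mulr0.
Qed.

Lemma phase1 : phase a b 1 = 1.
Proof.
have /andP[_ t0_lt1] := t0_itv a_gt0 b_gt0.
by rewrite /phase ltNge ltW//= mulr1 subrKC.
Qed.

Lemma rising_phase_t0 : m / a * t0 a b = 2^-1.
Proof. by rewrite /m /t0; field; rewrite aN abN. Qed.

Lemma falling_phase_t0 : m / b * t0 a b + (1 - m / b) = 2^-1.
Proof. by rewrite /m /t0; field; rewrite bN abN. Qed.

Lemma phase_gt0_lt1 t : 0 < t < 1 -> 0 < phase a b t < 1.
Proof.
move=> /andP[t_gt0 t_lt1]; rewrite /phase -/m;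
  case: (ltP t (t0 a b)) => [t_lt|t_ge].
  have ma0 := divr_gt0 m_gt0 a_gt0; rewrite mulr_gt0//=.
  rewrite -(ltr_pM2l ma0) rising_phase_t0 in t_lt; apply: lt_trans t_lt _; lra.
have mb0 := divr_gt0 m_gt0 b_gt0; have := falling_phase_t0.
rewrite -(ltr_pM2l mb0) mulr1 in t_lt1; rewrite -(ler_pM2l mb0) in t_ge.
by move: (m / b) (m / b * t) (m / b * t0 a b) t_lt1 t_ge => x y z *; lra.
Qed.

Lemma phase_itv t : 0 <= t <= 1 -> 0 <= phase a b t <= 1.
Proof.
move=> tI; have [->|t0] := eqVneq t 0; first by rewrite phase0 lexx ler01.
have [->|t1] := eqVneq t 1; first by rewrite phase1 lexx ler01.
have /phase_gt0_lt1/andP[/ltW-> /ltW->//] : 0 < t < 1.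
by rewrite !lt_neqAle t1 eq_sym t0.
Qed.

Section Orbit.
Variables (lam : R) (U W : R -> R).
Hypothesis orb : principal_orbit p lam U W.

Lemma half_wave_ode :
  eigen_ode p a b (m `^ p * lam) 0 1 (phi_ab_plus U a b) (wave_flux W a b).
Proof.
have [sol _ _ _] := orb.
have rise : eigen_ode p a b (m `^ p * lam) 0 (t0 a b)
    (fun t => U (m / a * t + 0))
    (fun t => m `^ (p - 1) * (a * W (m / a * t + 0))).
  apply: eigen_ode_reweight => //; rewrite mulr0 !addr0 rising_phase_t0.
  apply: eigen_ode_ge0 => // [t|]; first exact: (orbit_flux_ge0 p_gt1 orb).
  by apply: hamiltonian_solS sol; lra.
have fall : eigen_ode p a b (m `^ p * lam) (t0 a b) 1
    (fun t => U (m / b * t + (1 - m / b)))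
    (fun t => m `^ (p - 1) * (b * W (m / b * t + (1 - m / b)))).
  apply: eigen_ode_reweight => //; rewrite mulr1 subrKC falling_phase_t0.
  apply: eigen_ode_le0 => // [t|]; first exact: (orbit_flux_le0 p_gt1 orb).
  by apply: hamiltonian_solS sol; lra.
have := hamiltonian_sol_glue rise fall.
rewrite addr0 rising_phase_t0 falling_phase_t0.
rewrite (orbit_flux_half p_gt1 orb) !mulr0 => /(_ erefl erefl).
rewrite /eigen_ode; congr hamiltonian_sol; apply/funext => t.
  by rewrite phi_ab_plusE /phase addr0; case: ifP.
by rewrite /wave_flux /phase addr0; case: ifP.
Qed.

Lemma phi_ab_plus0 : phi_ab_plus U a b 0 = 0.
Proof. by rewrite phi_ab_plusE phase0 (orbit0 orb). Qed.

Lemma phi_ab_plus1 : phi_ab_plus U a b 1 = 0.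
Proof. by rewrite phi_ab_plusE phase1 (orbit1 orb). Qed.

Lemma phi_ab_plus_gt0 t : 0 < t < 1 -> 0 < phi_ab_plus U a b t.
Proof. by move=> /phase_gt0_lt1 tI; rewrite phi_ab_plusE (orbit_gt0 orb). Qed.

Lemma wave_flux0 : wave_flux W a b 0 = m `^ (p - 1) * (a * W 0).
Proof.
have /andP[t0_gt0 _] := t0_itv a_gt0 b_gt0.
by rewrite /wave_flux t0_gt0 phase0.
Qed.

Lemma wave_flux0_gt0 : 0 < wave_flux W a b 0.
Proof.
by rewrite wave_flux0 !mulr_gt0 ?powR_gt0 ?(orbit_flux0_gt0 p_gt1 orb).
Qed.

Lemma wave_flux1 : wave_flux W a b 1 = - (m `^ (p - 1) * (b * W 0)).
Proof.
have /andP[_ t0_lt1] := t0_itv a_gt0 b_gt0.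
by rewrite /wave_flux ltNge ltW//= phase1 (orbit_flux1 p_gt1 orb) !mulrN.
Qed.

End Orbit.
End PositiveWave.

Definition full_wave f a b t : R :=
  if t < 1 then phi_ab_plus f a b t else phi_ab_minus f a b (t - 1).

Definition full_wave_flux W a b t : R :=
  if t < 1 then wave_flux W a b t else - wave_flux W b a (t - 1).

Lemma phi_abE f a b : phi_ab f a b = periodize 2 (full_wave f a b).
Proof. by []. Qed.

Definition phi_ab_flux W a b := periodize 2 (full_wave_flux W a b).

Lemma eq_phi_ab f g a b : 0 < a -> 0 < b ->
  (forall x, 0 <= x <= 1 -> f x = g x) -> phi_ab f a b =1 phi_ab g a b.
Proof.
move=> a0 b0 fg t; rewrite !phi_abE /periodize /full_wave.
have := periodize_itv (ltr0n R 2) t; move: (t - _) => r rI.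
case: ltP => r1; rewrite ?phi_ab_minusE// !phi_ab_plusE// ?fg//;
  by apply: phase_itv => //; lra.
Qed.

Section PhiOrbit.
Variables (lam a b : R) (U W : R -> R).
Hypotheses (a_gt0 : 0 < a) (b_gt0 : 0 < b) (orb : principal_orbit p lam U W).
Let m := (a + b) / 2.

Lemma full_wave_ode :
  eigen_ode p a b (m `^ p * lam) 0 2 (full_wave U a b) (full_wave_flux W a b).
Proof.
have up := half_wave_ode a_gt0 b_gt0 orb.
have down : eigen_ode p a b (m `^ p * lam) 1 2
    (fun t => - phi_ab_plus U b a (t - 1)) (fun t => - wave_flux W b a (t - 1)).
  apply: (hamiltonian_sol_shift (d := -1) (u := fun t => - phi_ab_plus U b a t)
    (w := fun t => - wave_flux W b a t)).
  rewrite subrr (_ : 2 - 1 = 1); last by ring.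
  by rewrite /m addrC; exact: eigen_ode_opp (half_wave_ode b_gt0 a_gt0 orb).
have := hamiltonian_sol_glue up down.
rewrite subrr (phi_ab_plus0 _ _ orb)// (phi_ab_plus1 _ _ orb)// oppr0.
rewrite (wave_flux1 _ _ orb)// wave_flux0// (addrC b a) => /(_ erefl erefl).
rewrite /eigen_ode; congr hamiltonian_sol.
by apply/funext => t; rewrite /full_wave phi_ab_minusE.
Qed.

Lemma phi_ab_ode s T :
  eigen_ode p a b (m `^ p * lam) s T (phi_ab U a b) (phi_ab_flux W a b).
Proof.
have lt21 : (2 < 1 :> R) = false by apply/negbTE; rewrite -leNgt ler1n.
rewrite phi_abE; apply: hamiltonian_sol_periodize full_wave_ode _ _ => //.
  rewrite /full_wave ltr01 lt21 (_ : 2 - 1 = 1 :> R); last by ring.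
  rewrite phi_ab_minusE// (phi_ab_plus0 _ _ orb)//.
  by rewrite (phi_ab_plus1 _ _ orb)// oppr0.
rewrite /full_wave_flux ltr01 lt21 (_ : 2 - 1 = 1 :> R); last by ring.
by rewrite (wave_flux1 _ _ orb)// wave_flux0// opprK (addrC b a).
Qed.

Lemma phi_ab_flux0_gt0 : 0 < phi_ab_flux W a b 0.
Proof.
rewrite /phi_ab_flux (periodizeE (ltr0n R 2) _ (n := 0)); last by lra.
by rewrite mulr0 subr0 /full_wave_flux ltr01 (wave_flux0_gt0 _ _ orb).
Qed.

Lemma phi_ab_fluxN1_lt0 : phi_ab_flux W a b (-1) < 0.
Proof.
rewrite /phi_ab_flux (periodizeE (ltr0n R 2) _ (n := -1));
  last by rewrite mulrN1; lra.
rewrite (_ : -1 - 2 * (-1)%:~R = 1 :> R); last by rewrite mulrN1; ring.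
by rewrite /full_wave_flux ltxx subrr oppr_lt0 (wave_flux0_gt0 _ _ orb).
Qed.

Lemma phi_ab_eq0 t : phi_ab U a b t = 0 <-> exists n : int, t = n%:~R.
Proof.
rewrite phi_abE /periodize; have := periodize_itv (ltr0n R 2) t.
set n := Num.floor (t / 2); set r := t - 2 * n%:~R => rI.
have tE : t = r + 2 * n%:~R by rewrite /r subrK.
split=> [|[k tk]]; last first.
  have rk : r = (k - 2 * n)%:~R by rewrite /r tk intrB intrM.
  have /orP[/eqP r0|/eqP r1] : (k - 2 * n == 0) || (k - 2 * n == 1).
    move: rI; rewrite rk (ler_int _ 0) (ltr_int _ _ 2).
    by case: (k - 2 * n) => [[|[|]]|].
    by rewrite rk r0 /full_wave ltr01 (phi_ab_plus0 _ _ orb).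
  rewrite rk r1 /full_wave ltxx subrr phi_ab_minusE//.
  by rewrite (phi_ab_plus0 _ _ orb)// oppr0.
rewrite /full_wave; case: ltgtP => [r1|r1|r1].
- have [r0 _|r0] := eqVneq r 0.
    by exists (2 * n); rewrite tE r0 add0r intrM.
  have := phi_ab_plus_gt0 a_gt0 b_gt0 orb (t := r).
  by rewrite lt_neqAle eq_sym r0 r1 /=; lra.
- rewrite phi_ab_minusE//; have := phi_ab_plus_gt0 b_gt0 a_gt0 orb (t := r - 1).
  by lra.
- by exists (1 + 2 * n); rewrite tE r1 intrD intrM.
Qed.

End PhiOrbit.
End Waves.

Section Eigenvalues.
Variable R : realType.
Implicit Types (p a b L : R) (k : nat).

Lemma pi_p_ge0 p : 0 <= pi_p p.
Proof. by rewrite mulr_ge0// Rintegral_ge0// => t _; exact: powR_ge0. Qed.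

Lemma lambda_kpE p k L : 0 < L ->
  lambda_kp p k L = (k%:R / L) `^ p * lambda_kp p 1 1.
Proof.
move=> L0; rewrite /lambda_kp mulr1n mul1r divr1 mulrAC.
by rewrite powRM ?pi_p_ge0 ?divr_ge0 ?(ltW L0)// mulrCA.
Qed.

Lemma lambda_ab_kpE p a b k L : 0 < a -> 0 < b -> 0 < L ->
  lambda_ab_kp p a b k L = ((a + b) / 2) `^ p * lambda_kp p k L.
Proof.
move=> a0 b0 L0; have ab0 : 0 <= (a + b) / 2 by rewrite divr_ge0 ?addr_ge0 ?ltW.
rewrite /lambda_ab_kp !(lambda_kpE _ _ L0) -mulrA powRM ?ler0n// mulr1n div1r.
by rewrite (powRM _ (ler0n _ k)) ?invr_ge0 ?(ltW L0)//; ring.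
Qed.

Lemma lambda_kp_inj p L : 0 < p -> 0 < L -> 0 < lambda_kp p 1 1 ->
  injective (fun k => lambda_kp p k L).
Proof.
move=> p0 L0 lam0 k k'.
rewrite !(lambda_kpE _ _ L0) => /(mulIf (lt0r_neq0 lam0)).
move=> /(powR_injective p0).
rewrite !nnegrE !divr_ge0 ?(ltW L0)// => /(_ isT isT).
have Li : L^-1 != 0 by rewrite invr_eq0 gt_eqF.
by move=> /(mulIf Li)/eqP; rewrite eqr_nat => /eqP.
Qed.

Lemma lambda_ab_kp_inj p a b L : 0 < p -> 0 < a -> 0 < b -> 0 < L ->
  0 < lambda_kp p 1 1 -> injective (fun k => lambda_ab_kp p a b k L).
Proof.
move=> p0 a0 b0 L0 lam0 k k'; rewrite !lambda_ab_kpE//.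
have ab0 : ((a + b) / 2) `^ p != 0.
  by rewrite gt_eqF// powR_gt0// divr_gt0// addr_gt0.
by move=> /(mulfI ab0); exact: lambda_kp_inj.
Qed.

End Eigenvalues.

Section Eigenfunctions.
Variables (R : realType) (p lam a b L : R) (U W : R -> R).
Hypotheses (p_gt1 : 1 < p) (a_gt0 : 0 < a) (b_gt0 : 0 < b) (L_gt0 : 0 < L).
Hypothesis orb : principal_orbit p lam U W.
Implicit Types (u w : R -> R) (t c s T : R) (k : nat) (n : int).
Let Lam := ((a + b) / 2) `^ p * lam.
Let Lam_gt0 : 0 < Lam.
Proof.
rewrite mulr_gt0 ?(orbit_lam_gt0 p_gt1 orb)//.
by rewrite powR_gt0// divr_gt0// addr_gt0.
Qed.

Lemma phi_ab_int n : phi_ab U a b n%:~R = 0.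
Proof. by apply/(phi_ab_eq0 a_gt0 b_gt0 orb); exists n. Qed.

Lemma phi_ab_wave_ode r c n : 0 <= c -> 0 <= r ->
  eigen_ode p a b (r `^ p * Lam) 0 L (fun t => c * phi_ab U a b (r * t + n%:~R))
    (fun t => (c * r) `^ (p - 1) * phi_ab_flux p W a b (r * t + n%:~R)).
Proof.
by move=> c0 r0; apply: eigen_ode_scale => //; exact: phi_ab_ode.
Qed.

Lemma phi_ab_wave_eigenfunction k n c u : (0 < k)%N -> 0 < c ->
  (forall t, 0 <= t <= L -> u t = c * phi_ab U a b (k%:R * t / L + n%:~R)) ->
  eigenfunction_ab p a b L ((k%:R / L) `^ p * Lam) u.
Proof.
move=> k0 c0 uE; have LN : L != 0 by rewrite gt_eqF.
have kN : k%:R != 0 :> R by rewrite pnatr_eq0 -lt0n.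
have kL0 : 0 <= k%:R / L by rewrite divr_ge0// ltW.
have wave := phi_ab_wave_ode n (ltW c0) kL0.
split.
  apply: (eigen_ode_weak p_gt1 a_gt0 b_gt0 L_gt0 _ wave) => [t tI||].
  - by rewrite uE// mulrAC.
  - by rewrite mulr0 add0r phi_ab_int mulr0.
  - rewrite divfK// (_ : k%:R + n%:~R = (k%:Z + n)%:~R) ?phi_ab_int ?mulr0//.
    by rewrite intrD.
exists (L / (2 * k%:R)); have tI : 0 <= L / (2 * k%:R) <= L.
  rewrite divr_ge0 ?mulr_ge0 ?(ltW L_gt0)//= ler_pdivrMr ?mulr_gt0 ?ltr0n//.
  by rewrite ler_peMr ?(ltW L_gt0)// -natrM ler1n muln_gt0.
split=> //; rewrite uE// mulf_neq0 ?(gt_eqF c0)//; apply/eqP.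
have -> : k%:R * (L / (2 * k%:R)) / L = 2^-1 by field; rewrite LN kN.
move=> /(phi_ab_eq0 a_gt0 b_gt0 orb)[m mE].
have : (2 * (m - n))%:~R = 1%:~R :> R by rewrite intrM intrB -mE; field.
by move/intr_inj; case: (m - n) => [[|[|j]]|[|j]].
Qed.

Lemma eigen_ode_phi_ab n lam' u w : 0 < lam' -> eigen_ode p a b lam' 0 L u w ->
  u 0 = 0 -> 0 < w 0 / phi_ab_flux p W a b n%:~R ->
  exists r c, [/\ 0 < r, 0 < c, lam' = r `^ p * Lam &
    forall t, 0 <= t <= L -> u t = c * phi_ab U a b (r * t + n%:~R)].
Proof.
move=> lam'0 sol u0; set z := phi_ab_flux p W a b n%:~R => ratio_gt0.
have zN : z != 0 by apply: contraTneq ratio_gt0 => ->; rewrite invr0 mulr0 ltxx.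
have pN : p != 0 by rewrite gt_eqF// (lt_trans ltr01 p_gt1).
pose r := (lam' / Lam) `^ p^-1; pose c := (w 0 / z) `^ (p - 1)^-1 / r.
have r0 : 0 < r by rewrite powR_gt0// divr_gt0.
have c0 : 0 < c by rewrite divr_gt0// powR_gt0.
have rE : r `^ p * Lam = lam'.
  by rewrite -powRrM mulVf// powRr1 ?divr_ge0 ?ltW// divfK ?gt_eqF.
have crE : (c * r) `^ (p - 1) * z = w 0.
  rewrite divfK ?gt_eqF// -powRrM mulVf ?powRr1 ?(ltW ratio_gt0) ?divfK//.
  by rewrite subr_eq0 gt_eqF.
have wave := phi_ab_wave_ode n (ltW c0) (ltW r0); rewrite rE in wave.
exists r, c; split=> // t tI.
have [||->//] := eigen_ode_unique p_gt1 a_gt0 b_gt0 lam'0 sol wave _ _ tI.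
  by rewrite mulr0 add0r phi_ab_int mulr0.
by rewrite mulr0 add0r crE.
Qed.

Lemma dirichlet_ode_phi_ab n lam' u w : 0 < lam' ->
  eigen_ode p a b lam' 0 L u w ->
  u 0 = 0 -> u L = 0 -> 0 < w 0 / phi_ab_flux p W a b n%:~R ->
  exists2 k, (0 < k)%N & lam' = (k%:R / L) `^ p * Lam /\
    exists2 c, 0 < c & forall t, 0 <= t <= L ->
      u t = c * phi_ab U a b (k%:R * t / L + n%:~R).
Proof.
move=> lam'0 sol u0 uL ratio_gt0.
have [r [c [r0 c0 lam'E uE]]] := eigen_ode_phi_ab lam'0 sol u0 ratio_gt0.
have := uE L; rewrite uL (ltW L_gt0) lexx => /(_ isT)/esym/eqP.
rewrite mulf_eq0 gt_eqF//= => /eqP/(phi_ab_eq0 a_gt0 b_gt0 orb)[m mE].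
have rL : r * L = (m - n)%:~R by rewrite intrB -mE addrK.
have := mulr_gt0 r0 L_gt0; rewrite rL ltr0z; case: (m - n) rL => // k rL k0.
have rE : r = k%:R / L by rewrite -[k%:R]rL mulfK// gt_eqF.
exists k => //; split; first by rewrite -rE.
by exists c => // t tI; rewrite uE// rE mulrAC.
Qed.

Lemma eigenfunction_abP lam' u : eigenfunction_ab p a b L lam' u <->
  exists2 k, (0 < k)%N & lam' = (k%:R / L) `^ p * Lam /\
    exists c, 0 < c /\
      ((forall t, 0 <= t <= L -> u t = c * phi_ab U a b (k%:R * t / L)) \/
       (forall t, 0 <= t <= L -> u t = c * phi_ab U a b (k%:R * t / L - 1))).
Proof.
split=> [|[k k0 [-> [c [c0 [uE|uE]]]]]]; last 2 first.
- by apply: (phi_ab_wave_eigenfunction (n := 0) k0 c0) => t /uE; rewrite addr0.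
- by apply: (phi_ab_wave_eigenfunction (n := -1) k0 c0) => t tI; rewrite uE.
move=> [/(weak_eigen_ode p_gt1 a_gt0 b_gt0 L_gt0)[v [w [uv sol v0 vL]]]].
move=> [t1 [t1I ut1]].
have lam'0 : 0 < lam'.
  rewrite ltNge; apply: contraNN ut1 => lam'0.
  by rewrite uv// (eigen_ode_nonpos p_gt1 a_gt0 b_gt0 lam'0 sol v0 vL t1I).
have [w0|w0|w0] := ltgtP 0 (w 0).
- have [|k k0 [lam'E [c c0 vE]]] :=
      dirichlet_ode_phi_ab (n := 0) lam'0 sol v0 vL.
    by rewrite divr_gt0// (phi_ab_flux0_gt0 p_gt1 a_gt0 b_gt0 orb).
  by exists k => //; split=> //; exists c; split=> //; left=> t tI;
    rewrite uv// vE// addr0.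
- have [|k k0 [lam'E [c c0 vE]]] :=
      dirichlet_ode_phi_ab (n := -1) lam'0 sol v0 vL.
    by rewrite nmulr_rgt0// invr_lt0 (phi_ab_fluxN1_lt0 p_gt1 a_gt0 b_gt0 orb).
  by exists k => //; split=> //; exists c; split=> //; right=> t tI;
    rewrite uv// vE.
have [v1 _] := eigen_ode_unique p_gt1 a_gt0 b_gt0 lam'0 sol
  (@eigen_ode_zero _ _ p_gt1 a b lam' 0 L) v0 (esym w0) t1I.
by move: ut1; rewrite uv// v1 eqxx.
Qed.

End Eigenfunctions.

Section PrincipalEigenfunction.
Variables (R : realType) (p a b L : R) (phip : R -> R).
Hypotheses (p_gt1 : 1 < p) (a_gt0 : 0 < a) (b_gt0 : 0 < b) (L_gt0 : 0 < L).
Hypothesis principal : principal_eigenfunction_p p phip.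

Lemma principal_eigenfunction_orbit : exists U W,
  principal_orbit p (lambda_kp p 1 1) U W /\
  forall t, 0 <= t <= 1 -> phip t = U t.
Proof.
have [weak phip_gt0 _] := principal.
have fluxE : flux_p p = flux_ab p 1 1 by apply/funext => x; exact: flux_pE.
move: weak; rewrite fluxE.
move=> /(weak_eigen_ode p_gt1 ltr01 ltr01 ltr01)[U [W [phipE sol U0 U1]]].
exists U, W; split=> //; split=> // t tI.
by rewrite -phipE ?phip_gt0//; lra.
Qed.

Lemma lambda_kp11_gt0 : 0 < lambda_kp p 1 1.
Proof.
by have [U [W [orb _]]] := principal_eigenfunction_orbit;
  exact: orbit_lam_gt0 orb.
Qed.

Lemma eigenfunction_abE lam u : eigenfunction_ab p a b L lam u <->
  exists2 k : nat, (0 < k)%N & lam = lambda_ab_kp p a b k L /\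
    exists c, 0 < c /\
      ((forall t, 0 <= t <= L -> u t = c * phi_ab phip a b (k%:R * t / L)) \/
       (forall t, 0 <= t <= L -> u t = c * phi_ab phip a b (k%:R * t / L - 1))).
Proof.
have [U [W [orb phipE]]] := principal_eigenfunction_orbit.
have phiE : phi_ab phip a b = phi_ab U a b by apply/funext/eq_phi_ab.
rewrite phiE (propext (eigenfunction_abP p_gt1 a_gt0 b_gt0 L_gt0 orb lam u)).
by split=> -[k k0 [-> uE]]; exists k;
  rewrite // lambda_ab_kpE// (lambda_kpE _ k L_gt0) mulrCA.
Qed.

End PrincipalEigenfunction.

Theorem theorem2 (R : realType) (p a b L : R) (phip : R -> R) :
  1 < p -> 0 < a -> 0 < b -> 0 < L ->
  principal_eigenfunction_p p phip ->
  (spectrum_ab p a b L = [set lam | exists k : nat, (0 < k)%N /\ lam = lambda_ab_kp p a b k L]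
   /\ [set lam | exists k : nat, (0 < k)%N /\ lam = lambda_ab_kp p a b k L]
      = [set lam | exists k : nat, (0 < k)%N /\ lam = ((a + b) / 2) `^ p * lambda_kp p k L])
  /\
  (forall (k : nat) (u : R -> R), (0 < k)%N ->
     (eigenfunction_ab p a b L (lambda_ab_kp p a b k L) u <->
      exists c : R, 0 < c /\
        ((forall t, 0 <= t <= L -> u t = c * phi_ab phip a b (k%:R * t / L))
         \/ (forall t, 0 <= t <= L -> u t = c * phi_ab phip a b (k%:R * t / L - 1))))).
Proof.
move=> p1 a0 b0 L0 principal.
have eigenE := eigenfunction_abE p1 a0 b0 L0 principal.
split; [split|].
- apply/seteqP; split=> lam /= [].
    by move=> u /eigenE[k k0 [lamE _]]; exists k.
  move=> k [k0 ->]; exists (fun t => 1 * phi_ab phip a b (k%:R * t / L)).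
  by apply/eigenE; exists k => //; split=> //; exists 1; split=> //; left.
- by apply/seteqP; split=> lam /= [k [k0 ->]]; exists k; rewrite lambda_ab_kpE.
- move=> k u k0; split=> [/eigenE[k' _ [lamE uE]]|uE]; last first.
    by apply/eigenE; exists k.
  suff -> : k = k' by [].
  apply: lambda_ab_kp_inj lamE => //; first exact: lt_trans p1.
  exact: lambda_kp11_gt0 principal.
Qed.
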